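(* Suppose $n_Q=0$, i.e. only the $P$-sample of size $n_P$ is available. Let $\theta=\{\alpha,\beta_P,\beta_Q,\gamma,c_\lambda,r_\lambda,C_\beta,C_\alpha,C_\gamma\}$ be fixed and let $\Pi(\theta)$, the excess risk $\mathcal{R}_Q$, the $k$-nearest neighbor classifier $\widehat f_{NN}(\mathbf{x})=\mathbb{I}(\widehat\eta_{k_P}(\mathbf{x})\ge 1/2)$ and the adaptive classifier $\widehat f_{pa}$ be as defined in the context. Then, as $n_P\to\infty$: (1a) If $\beta_P>\gamma\beta_Q$ and $k_P\asymp n_P^{\frac{2\beta_P}{2\beta_P+d}}$, then $\sup_{(P,Q)\in\Pi(\theta)}\mathcal{R}_Q(\widehat f_{NN})\lesssim n_P^{-\frac{(1+\alpha)\beta_P}{\gamma(2\beta_P+d)}}$. (1b) If $\beta_P\le\gamma\beta_Q$ and $k_P\asymp n_P^{\frac{2\gamma\beta_Q}{2\gamma\beta_Q+d}}$, then $\sup_{(P,Q)\in\Pi(\theta)}\mathcal{R}_Q(\widehat f_{NN})\lesssim n_P^{-\frac{(1+\alpha)\beta_Q}{2\gamma\beta_Q+d}}$. (2a) If $\beta_P>\gamma\beta_Q$, then $\sup_{(P,Q)\in\Pi(\theta)}\mathcal{R}_Q(\widehat f_{pa})\lesssim \left(\frac{n_P}{\log^2(n_P)}\right)^{-\frac{(1+\alpha)\beta_P}{\gamma(2\beta_P+d)}}$. (2b) If $\beta_P\le\gamma\beta_Q$, then $\sup_{(P,Q)\in\Pi(\theta)}\mathcal{R}_Q(\widehat f_{pa})\lesssim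 \left(\frac{n_P}{\log^2(n_P)}\right)^{-\frac{(1+\alpha)\beta_Q}{2\gamma\beta_Q+d}}$.
   Context: Notation. $d\ge1$ is a fixed dimension, $\|\cdot\|$ is the Euclidean norm, $B(\mathbf{x},r)$ is the Euclidean ball of radius $r$ centered at $\mathbf{x}$, $\lambda$ is Lebesgue measure on $\mathbb{R}^d$. For positive sequences, $a_n\lesssim b_n$ means $a_n\le c\,b_n$ for some constant $c>0$ and all large enough $n$; $a_n\asymp b_n$ means $a_n\lesssim b_n$ and $b_n\lesssim a_n$. Model. $P,Q$ are probability distributions on $[0,1]^d\times\{0,1\}$; a draw is written $(\mathbf{X},Y)$. $P_{\mathbf{X}},Q_{\mathbf{X}}$ are the marginal distributions of $\mathbf{X}$, and $\eta_P(\mathbf{x})=P(Y=1|\mathbf{X}=\mathbf{x})$, $\eta_Q(\mathbf{x})=Q(Y=1|\mathbf{X}=\mathbf{x})$. The data are $n_P$ i.i.d. observations $(\mathbf{X}_i^P,Y_i^P)$, $1\le i\le n_P$, from $P$ (there are no observations from $Q$). Class $\Pi(\theta)$. For $\theta=\{\alpha,\beta_P,\beta_Q,\gamma,c_\lambda,r_\lambda,C_\beta,C_\alpha,C_\gamma\}$ with $\alpha\ge0$, $\beta_P,\beta_Q\in[0,1]$, $\max(\beta_P,\beta_Q)>0$, and $\gamma,c_\lambda,r_\lambda,C_\beta,C_\alpha,C_\gamma>0$, $\Pi(\theta)$ is the set of all pairs $(P,Q)$ satisfying, for some $\Omega\subset[0,1]^d$: (i) (common support and strong density) $\Omega$ is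 the common support of $P_{\mathbf{X}}$ and $Q_{\mathbf{X}}$; $\lambda[\Omega\cap B(\mathbf{x},r)]\ge c_\lambda\lambda[B(\mathbf{x},r)]$ for all $0<r<r_\lambda$ and $\mathbf{x}\in\Omega$; and $c_\lambda<\frac{dP_{\mathbf{X}}}{d\lambda}(\mathbf{x})<c_\lambda^{-1}$, $c_\lambda<\frac{dQ_{\mathbf{X}}}{d\lambda}(\mathbf{x})<c_\lambda^{-1}$ for all $\mathbf{x}\in\Omega$. (ii) (Hölder smoothness) $|\eta_P(\mathbf{x}_1)-\eta_P(\mathbf{x}_2)|\le C_\beta\|\mathbf{x}_1-\mathbf{x}_2\|^{\beta_P}$ and $|\eta_Q(\mathbf{x}_1)-\eta_Q(\mathbf{x}_2)|\le C_\beta\|\mathbf{x}_1-\mathbf{x}_2\|^{\beta_Q}$ for all $\mathbf{x}_1,\mathbf{x}_2\in\Omega$. (iii) (Tsybakov noise) $Q_{\mathbf{X}}(|\eta_Q(\mathbf{X})-1/2|<t)\le C_\alpha t^\alpha$ for all $t\in(0,1/2]$. (iv) (relative signal exponent) for all $\mathbf{x}\in\Omega$, $(\eta_P(\mathbf{x})-1/2)(\eta_Q(\mathbf{x})-1/2)\ge0$ and $|\eta_P(\mathbf{x})-1/2|\ge C_\gamma|\eta_Q(\mathbf{x})-1/2|^\gamma$. Excess risk. For a classifier $f$ with values in $\{0,1\}$, $\mathcal{E}_Q(f)=Q(f(\mathbf{X})\ne Y)$. Let $f_Q^*(\cdot)=\mathbb{I}(\eta_Q(\cdot)\ge1/2)$.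 For a data-dependent classifier $\widehat f$, $\mathcal{R}_Q(\widehat f)=\mathbb{E}(\mathcal{E}_Q(\widehat f))-\mathcal{E}_Q(f_Q^* )$, the expectation being over the training data. Classifiers. For $\mathbf{x}\in[0,1]^d$, let $Y_{(i)}^P(\mathbf{x})$ be the label of the $i$th nearest covariate to $\mathbf{x}$ among $\mathbf{X}_1^P,\dots,\mathbf{X}_{n_P}^P$, and $\widehat\eta_{k_P}(\mathbf{x})=\frac1{k_P}\sum_{i=1}^{k_P}Y_{(i)}^P(\mathbf{x})$ for $1\le k_P\le n_P$. Then $\widehat f_{NN}(\mathbf{x})=\mathbb{I}(\widehat\eta_{k_P}(\mathbf{x})\ge1/2)$. The adaptive classifier $\widehat f_{pa}$: for given $\mathbf{x}$, put $r_{k_P}=\sqrt{k_P}\,|\widehat\eta_{k_P}(\mathbf{x})-1/2|$, and let $\widehat k_P$ be the smallest $k_P\in\{1,\dots,n_P\}$ with $r_{k_P}>\sqrt{[d+\log(n_P)]\log(n_P)}$, or $\widehat k_P=n_P$ if there is no such $k_P$. Then $\widehat f_{pa}(\mathbf{x})=\mathbb{I}(\widehat\eta_{\widehat k_P}(\mathbf{x})\ge1/2)$. *)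

(* Defs.v *)
From HB Require Import structures.
From mathcomp Require Import all_boot all_order all_algebra.
From mathcomp Require Import all_classical all_reals all_analysis.

Set Implicit Arguments.
Unset Strict Implicit.
Unset Printing Implicit Defensive.

Import Order.TTheory GRing.Theory Num.Theory.
Import numFieldNormedType.Exports.

Local Open Scope classical_set_scope.
Local Open Scope ring_scope.

Section tuple_power.
Context (disp : measure_display) (T : measurableType disp) (R : realType).
Variable mu : {sigma_finite_measure set T -> \bar R}.

Definition tuple_cons (n : nat) (p : n.-tuple T * T) : n.+1.-tuple T :=
  [tuple of p.2 :: p.1].

Lemma measurable_tuple_cons (n : nat) :
  measurable_fun [set: n.-tuple T * T] (@tuple_cons n).
Proof. exact: (measurable_cons measurable_snd measurable_fst). Qed.

HB.instance Definition _ (n : nat) :=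
  isMeasurableFun.Build _ _ _ _ (@tuple_cons n) (@measurable_tuple_cons n).

Section tuple_extend.
Context (n : nat) (nu : {measure set (n.-tuple T) -> \bar R}).

Definition tuple_extend : set (n.+1.-tuple T) -> \bar R :=
  pushforward (product_measure1 nu mu) (@tuple_cons n).

Let tuple_extend0 : tuple_extend set0 = 0%E.
Proof. by rewrite /tuple_extend /pushforward preimage_set0 measure0. Qed.

Let tuple_extend_ge0 A : (0 <= tuple_extend A)%E.
Proof. exact: measure_ge0. Qed.

Let tuple_extend_sigma_additive : semi_sigma_additive tuple_extend.
Proof.
apply: (@measure_semi_sigma_additive _ _ _ (pushforward _ _)).
exact: measurable_tuple_cons.
Qed.

HB.instance Definition _ := isMeasure.Build _ _ _ tuple_extend
  tuple_extend0 tuple_extend_ge0 tuple_extend_sigma_additive.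

End tuple_extend.

(* The n-fold product measure mu (x) ... (x) mu on n.-tuple T. *)
Fixpoint tuple_power (n : nat) : {measure set (n.-tuple T) -> \bar R} :=
  match n with
  | 0 => \d_([tuple] : 0.-tuple T)
  | m.+1 => tuple_extend (tuple_power m)
  end.

Lemma tuple_power_box (n : nat) (A : 'I_n -> set T) :
  (forall i, measurable (A i)) ->
  tuple_power n [set t | forall i, A i (tnth t i)]
    = (\prod_(i < n) mu (A i))%E.
Proof.
elim: n A => [|n IH] A mA.
  by rewrite big_ord0 /= diracE mem_set//= => -[].
rewrite big_ord_recl /= /tuple_extend /pushforward.
rewrite (_ : _ @^-1` _ =
    [set t | forall i, A (lift ord0 i) (tnth t i)] `*` A ord0); last first.
  apply/seteqP; split => [[t x] /= H|[t x] /= [H1 H2] i].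
    split; last by have := H ord0; rewrite /tuple_cons/= tnth0.
    by move=> i; have := H (lift ord0 i); rewrite /tuple_cons/= tnthS.
  have [->|i0] := eqVneq i ord0; first by rewrite /tuple_cons/= tnth0.
  have [j -> _] := unlift_some (introN eqP (fun e => negP i0 (introT eqP (esym e)))).
  by rewrite /tuple_cons/= tnthS.
rewrite product_measure1E//; last first.
  rewrite (_ : [set _ | _] =
      \bigcap_(i in [set: 'I_n]) ((@tnth n T)^~ i @^-1` A (lift ord0 i))).
    apply: fin_bigcap_measurable => // i _.
    rewrite -[X in measurable X]setTI.
    exact: measurable_tnth.
  by apply/seteqP; split => [t H i _|t H i]; [exact: H|exact: (H i Logic.I)].
by rewrite (IH (fun i => A (lift ord0 i)))// muleC.
Qed.

End tuple_power.

HB.instance Definition _ d1 d2 (T1 : measurableType d1) (T2 : measurableType d2) :=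
  isMeasurableFun.Build _ _ _ _ (@fst T1 T2) (@measurable_fst _ _ T1 T2).

(* [measurableTypeR R] is R with its Borel sigma-algebra, the carrier of the
   library's [lebesgue_measure]; R^d is d.-tuple over it, with the product
   sigma-algebra. *)
Notation euclid R d := (d.-tuple (measurableTypeR R)).

Section euclidean.
Context (R : realType) (d : nat).

Local Notation point := (euclid R d).

Definition edist (x y : point) : R :=
  Num.sqrt (\sum_(i < d) ((tnth x i : R) - (tnth y i : R)) ^+ 2).

Definition eball (x : point) (r : R) : set point := [set y | edist x y <= r].

Definition unit_cube : set point :=
  [set x | forall i, 0 <= (tnth x i : R) <= 1].

Definition lebesgue_tuple : {measure set point -> \bar R} :=
  tuple_power (@lebesgue_measure R) d.

Definition msupport (mu : set point -> \bar R) : set point :=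
  [set x | forall r, 0 < r -> (0 < mu (eball x r))%E].

(* [p] is a version of the density of [mu] with respect to Lebesgue measure. *)
Definition is_density (mu : set point -> \bar R) (p : point -> R) : Prop :=
  [/\ measurable_fun setT p,
      forall x, 0 <= p x
    & forall A, measurable A -> mu A = (\int[lebesgue_tuple]_(x in A) (p x)%:E)%E].

End euclidean.

Section model.
Context (R : realType) (d : nat).

Local Notation point := (euclid R d).
Local Notation obs := (point * bool)%type.

Definition marginal (P : probability obs R) : probability point R :=
  distribution P (@fst point bool).

(* [eta] is a version of the conditional probability P(Y = 1 | X = x). *)
Definition is_regression (P : probability obs R) (eta : point -> R) : Prop :=
  [/\ measurable_fun setT eta,
      forall x, 0 <= eta x <= 1
    & forall A, measurable A ->
        P (A `*` [set true]) = (\int[marginal P]_(x in A) (eta x)%:E)%E].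

(* A distribution of (X, Y) on [0,1]^d x {0,1}. Conditional probabilities are
   determined only up to null sets, so the law comes with the version of
   P(Y = 1 | X = x) which the pointwise conditions of the class refer to. *)
Record joint_law := JointLaw {
  law :> probability obs R;
  eta : point -> R;
  law_cube : law (@unit_cube R d `*` setT) = 1%E;
  eta_regression : is_regression law eta
}.

Record params := Params {
  alpha : R;
  betaP : R;
  betaQ : R;
  gamma : R;
  c_lambda : R;
  r_lambda : R;
  C_beta : R;
  C_alpha : R;
  C_gamma : R
}.

Definition valid_params (th : params) : Prop :=
  [/\ 0 <= alpha th,
      0 <= betaP th <= 1,
      0 <= betaQ th <= 1,
      0 < Num.max (betaP th) (betaQ th)
    & [/\ 0 < gamma th, 0 < c_lambda th, 0 < r_lambda th
        & [/\ 0 < C_beta th, 0 < C_alpha th & 0 < C_gamma th]]].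

Definition strong_density (th : params) (P Q : joint_law) (Om : set point) : Prop :=
  [/\ Om = msupport (marginal P),
      Om = msupport (marginal Q),
      forall r x, 0 < r < r_lambda th -> Om x ->
        ((c_lambda th)%:E * lebesgue_tuple R d (eball x r)
           <= lebesgue_tuple R d (Om `&` eball x r))%E
    & exists p q : point -> R,
      [/\ is_density (marginal P) p,
          is_density (marginal Q) q
        & forall x, Om x ->
            c_lambda th < p x < (c_lambda th)^-1 /\
            c_lambda th < q x < (c_lambda th)^-1]].

Definition holder (C beta : R) (Om : set point) (f : point -> R) : Prop :=
  forall x1 x2, Om x1 -> Om x2 ->
    `|f x1 - f x2| <= C * (edist x1 x2) `^ beta.

Definition tsybakov_noise (C a : R) (Q : joint_law) : Prop :=
  forall t, 0 < t <= 2^-1 ->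
    (marginal Q [set x | (`|eta Q x - 2^-1| < t)%R] <= (C * t `^ a)%R%:E)%E.

Definition relative_signal (C g : R) (P Q : joint_law) (Om : set point) : Prop :=
  forall x, Om x ->
    0 <= (eta P x - 2^-1) * (eta Q x - 2^-1) /\
    C * `|eta Q x - 2^-1| `^ g <= `|eta P x - 2^-1|.

Definition Pi_class (th : params) : set (joint_law * joint_law) :=
  [set PQ | exists Om : set point,
    [/\ Om `<=` @unit_cube R d,
        strong_density th PQ.1 PQ.2 Om,
        holder (C_beta th) (betaP th) Om (eta PQ.1) /\
          holder (C_beta th) (betaQ th) Om (eta PQ.2),
        tsybakov_noise (C_alpha th) (alpha th) PQ.2
      & relative_signal (C_gamma th) (gamma th) PQ.1 PQ.2 Om]].

Definition risk (Q : joint_law) (f : point -> bool) : \bar R :=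
  law Q [set z | f z.1 != z.2].

Definition bayes (Q : joint_law) (x : point) : bool := 2^-1 <= eta Q x.

(* The expectation is over n i.i.d. observations from P. *)
Definition excess_risk (n : nat) (f : n.-tuple obs -> point -> bool)
    (P Q : joint_law) : \bar R :=
  (\int[tuple_power (law P) n]_s risk Q (f s) - risk Q (bayes Q))%E.

Definition sup_excess_risk (th : params) (n : nat)
    (f : n.-tuple obs -> point -> bool) : \bar R :=
  ereal_sup [set excess_risk f PQ.1 PQ.2 | PQ in Pi_class th].

(* [Y_(i)(x)] for 1 <= i <= n. The sort is stable: ties in distance are broken
   by the index of the observation. *)
Definition nn_label (n : nat) (s : n.-tuple obs) (x : point) (i : nat) : bool :=
  nth false
    [seq z.2 | z <- sort (fun u v : obs => edist u.1 x <= edist v.1 x) s] i.-1.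

Definition knn_eta (n k : nat) (s : n.-tuple obs) (x : point) : R :=
  (\sum_(1 <= i < k.+1) (nn_label s x i)%:R) / k%:R.

Definition f_NN (n k : nat) (s : n.-tuple obs) (x : point) : bool :=
  2^-1 <= knn_eta k s x.

Definition signal (n k : nat) (s : n.-tuple obs) (x : point) : R :=
  Num.sqrt k%:R * `|knn_eta k s x - 2^-1|.

Definition threshold (n : nat) : R :=
  Num.sqrt ((d%:R + ln n%:R) * ln n%:R).

Definition k_adaptive (n : nat) (s : n.-tuple obs) (x : point) : nat :=
  head n [seq k <- iota 1 n | threshold n < signal k s x].

Definition f_pa (n : nat) (s : n.-tuple obs) (x : point) : bool :=
  2^-1 <= knn_eta (k_adaptive s x) s x.

End model.

Definition lesssim (R : realType) (a b : nat -> \bar R) : Prop :=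
  exists2 c : R, 0 < c & \forall n \near \oo, (a n <= c%:E * b n)%E.

Definition asymp (R : realType) (a b : nat -> \bar R) : Prop :=
  lesssim a b /\ lesssim b a.

(* Main.v *)
(** Put beta = betaP if betaP > gamma betaQ and beta = gamma betaQ otherwise,
    and zeta(x) = |eta_Q(x) - 1/2|. In both regimes, as soon as
    zeta(x)^gamma >= A r^beta, every point of the support within distance r of x
    has eta_P - 1/2 of the sign of eta_Q(x) - 1/2 and of size at least a
    constant times zeta(x)^gamma. By the strong density condition and a Chernoff
    bound, the k nearest neighbors of x lie within r = C (k/n)^(1/d) of x, up to
    probability exp(-k).

    The neighbors' labels are controlled by exponential moments. The order of
    the observations by distance to x takes finitely many values and depends on
    the covariates only, so that for a fixed order the moment of the vote is a
    product of one-observation moments, bounded by integrating out one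
    observation at a time. The k-NN classifier thus errs at x with probability
    at most exp(-k) + exp(-c k zeta^(2 gamma)). The adaptive one errs only if some
    vote among the k* nearest neighbors deviates by the threshold, where k* is
    the balanced choice of k; outside that event it stops before k*, with the
    right sign.

    The excess risk is at most the integral of 2 zeta times the pointwise error,
    and a dyadic decomposition in zeta with the noise condition turns it into
    delta^(1 + alpha), delta being the scale at which the pointwise bound starts
    to be nontrivial. *)
From HB Require Import structures.
From mathcomp Require Import all_boot all_order all_algebra.
From mathcomp Require Import all_classical all_reals all_analysis.
From mathcomp Require Import measurable_realfun measurable_fun_approximation.
From mathcomp Require Import simple_functions ring lra.
Require Import Defs.

Set Implicit Arguments.
Unset Strict Implicit.
Unset Printing Implicit Defensive.

Import Order.TTheory GRing.Theory Num.Theory.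
Import numFieldNormedType.Exports.

Local Open Scope classical_set_scope.
Local Open Scope ring_scope.

(** * Integration against a measure given by a density *)

Section density.
Import HBNNSimple.
Context (R : realType).

(** The hypothesis on [m] settles the indicators of level sets, linearity the simple approximations
    of [f], and monotone convergence on both sides the limit. *)
Lemma ge0_integral_density d (T : measurableType d)
    (m mu : {measure set T -> \bar R}) (g : T -> R) (f : T -> \bar R) :
  measurable_fun setT g -> (forall x, 0 <= g x) ->
  (forall A, measurable A -> m A = \int[mu]_(x in A) (g x)%:E)%E ->
  measurable_fun setT f -> (forall x, 0 <= f x)%E ->
  (\int[m]_x f x = \int[mu]_x (f x * (g x)%:E))%E.
Proof.
move=> mg g0 mE mf f0.
pose h := nnsfun_approx measurableT mf.
have h_nd n k x : (n <= k)%N -> ((h n x)%:E <= (h k x)%:E)%E.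
  by move=> nk; rewrite lee_fin; exact/lefP/nd_nnsfun_approx.
have h_cvg x : (h n x)%:E @[n --> \oo] --> f x.
  exact: (cvg_nnsfun_approx measurableT mf (fun x _ => f0 x)).
have step n : (\int[m]_x (h n x)%:E = \int[mu]_x ((h n x)%:E * (g x)%:E))%E.
  under eq_integral do rewrite fimfunE -fsumEFin//.
  under [RHS]eq_integral.
    move=> x _.
    rewrite fimfunE -fsumEFin// ge0_mule_fsuml; last first.
      by move=> y; rewrite EFinM nnfun_muleindic_ge0.
    over.
  rewrite !ge0_integral_fsum//; last 4 first.
    - move=> z; apply: emeasurable_funM; last exact/measurable_EFinP.
      by apply/measurable_EFinP; exact: measurable_funM.
    - by move=> z x _; apply: mule_ge0; [rewrite EFinM nnfun_muleindic_ge0|rewrite lee_fin].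
    - by move=> z; apply/measurable_EFinP; exact: measurable_funM.
    - by move=> z x _; rewrite EFinM nnfun_muleindic_ge0.
  apply: eq_fsbigr => r _.
  under eq_integral do rewrite EFinM.
  under [RHS]eq_integral do rewrite EFinM -muleA.
  have mhr : measurable (h n @^-1` [set r]).
    exact: measurable_sfunP.
  have [r0|r0] := leP 0 r.
    rewrite [LHS]ge0_integralZl//; last first.
      by apply/measurable_EFinP.
    rewrite [RHS]ge0_integralZl//; last first.
    - by move=> x _; rewrite mule_ge0// lee_fin.
    - by apply: emeasurable_funM; exact/measurable_EFinP.
    congr (_ * _)%E; rewrite integral_indic// setIT mE// integral_mkcond.
    apply: eq_integral => x _; rewrite patchE indicE.
    by case: ifPn => _; rewrite ?mul1e ?mul0e.
  (* A nonnegative simple function has no negative value, so this level set is empty. *)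
  have h0 : h n @^-1` [set r] = set0.
    by apply/preimage10 => -[x _ hx]; move: r0; rewrite -hx ltNge fun_ge0.
  by rewrite h0 indic0; transitivity (0%E : \bar R); [|symmetry];
    apply: integral0_eq => x _ /=; rewrite ?mul0e ?mule0.
have fE x : f x = lim ((h n x)%:E @[n --> \oo]) by apply/esym/cvg_lim.
have fgE x : (f x * (g x)%:E)%E = lim ((h n x)%:E * (g x)%:E @[n --> \oo])%E.
  apply/esym/cvg_lim => //; exact: cvgeZr.
rewrite (eq_integral (fun x => lim ((h n x)%:E @[n --> \oo]))); last by move=> x _; rewrite -fE.
rewrite [RHS](eq_integral (fun x => lim ((h n x)%:E * (g x)%:E @[n --> \oo])%E));
  last by move=> x _; rewrite -fgE.
rewrite !monotone_convergence//.
- by under eq_fun do rewrite step.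
- by move=> n; apply: emeasurable_funM; exact/measurable_EFinP.
- by move=> n x _; rewrite mule_ge0// lee_fin.
- by move=> x _ n k nk; rewrite lee_wpmul2r ?lee_fin //; exact: (h_nd n k x nk).
- move=> n; exact/measurable_EFinP.
- by move=> n x _; rewrite lee_fin.
- by move=> x _ n k nk; rewrite h_nd.
Qed.

End density.

(** * Products of one-observation bounds *)

Section iid.
Context (R : realType) d (T : measurableType d) (P : probability T R).

(* An alias of [tuple_power], so as to carry the probability structure. *)
Definition iid n : set (n.-tuple T) -> \bar R := tuple_power P n.
Arguments iid n _ : clear implicits.

Lemma iid_setT n : iid n setT = 1%E.
Proof.
have /= := tuple_power_box P (A := fun _ : 'I_n => setT) (fun=> measurableT).
rewrite (_ : [set t | _] = setT); last by apply/seteqP; split.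
by rewrite /iid => ->; rewrite big1// => i _; exact: probability_setT.
Qed.

HB.instance Definition _ n := Measure.on (iid n).
HB.instance Definition _ n :=
  Measure_isProbability.Build _ _ _ (iid n) (iid_setT n).

Lemma ge0_integral_iidS n (f : n.+1.-tuple T -> \bar R) :
  measurable_fun setT f -> (forall s, 0 <= f s)%E ->
  (\int[iid n.+1]_s f s = \int[iid n]_s \int[P]_x f [tuple of x :: s])%E.
Proof.
move=> mf f0.
rewrite /iid/= /tuple_extend ge0_integral_pushforward// preimage_setT.
transitivity (\int[iid n \x P]_z (f \o @tuple_cons _ _ n) z)%E.
  by [].
rewrite fubini_tonelli1//.
  by apply: measurableT_comp => //; exact: measurable_tuple_cons.
by move=> z; exact: f0.
Qed.

End iid.
Arguments iid {R d T} P n _.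

Lemma measurable_map_tuple d1 d2 (T1 : measurableType d1) (T2 : measurableType d2)
    (pi : T1 -> T2) n : measurable_fun setT pi ->
  measurable_fun setT (fun s : n.-tuple T1 => [tuple of map pi s]).
Proof.
move=> mpi; apply/measurable_fun_tnthP => i.
rewrite (_ : _ \o _ = pi \o (@tnth _ _ ^~ i)); last first.
  by apply/funext => s /=; rewrite tnth_map.
by apply: measurableT_comp => //; exact: measurable_tnth.
Qed.

Section product_weights.
Context (R : realType) d1 d2 (T1 : measurableType d1) (T2 : measurableType d2).
Variables (P : probability T1 R) (pi : T1 -> T2).
Hypothesis mpi : measurable_fun setT pi.
Local Open Scope ereal_scope.

(* [pi] extracts the part of an observation on which [Phi] may depend: the
   covariate for the votes, nothing at all for the ball counts. *)
Lemma integral_iid_prod_le n (w : 'I_n -> T1 -> R) (rho : 'I_n -> R) :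
  (forall i, measurable_fun setT (w i)) -> (forall i z, (0 <= w i z)%R) ->
  (forall i, (0 <= rho i)%R) ->
  (forall i (phi : T2 -> \bar R), measurable_fun setT phi ->
     (forall x, 0 <= phi x) ->
     \int[P]_z (phi (pi z) * (w i z)%:E) <= (rho i)%:E * \int[P]_z phi (pi z)) ->
  forall Phi : n.-tuple T2 -> \bar R, measurable_fun setT Phi ->
    (forall t, 0 <= Phi t) ->
  \int[iid P n]_s (Phi [tuple of map pi s] * (\prod_(i < n) w i (tnth s i))%:E)
    <= (\prod_(i < n) rho i)%:E * \int[iid P n]_s Phi [tuple of map pi s].
Proof.
elim: n w rho => [|n IH] w rho mw w0 rho0 wrho Phi mPhi Phi0.
  rewrite big_ord0 mul1e; under eq_integral do rewrite big_ord0 mule1.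
  exact: lexx.
have mprod m (v : 'I_m -> T1 -> R) : (forall i, measurable_fun setT (v i)) ->
    measurable_fun setT (fun s : m.-tuple T1 => \prod_(i < m) v i (tnth s i))%R.
  move=> mv; apply: measurable_prod => i _.
  by apply: measurableT_comp => //; exact: measurable_tnth.
have mPhi' : measurable_fun setT (fun s : n.+1.-tuple T1 => Phi [tuple of map pi s]).
  by apply: measurableT_comp => //; exact: measurable_map_tuple.
have cons_map (x : T1) (s : n.-tuple T1) :
    [tuple of map pi [tuple of x :: s]] = [tuple of pi x :: [tuple of map pi s]].
  exact/val_inj.
have mcons : measurable_fun setT (fun z : n.-tuple T2 * T1 => [tuple of pi z.2 :: z.1]).
  by apply: measurable_cons => //; exact: measurableT_comp.
have mcons1 : measurable_fun setT (fun z : n.-tuple T1 * T1 => [tuple of z.2 :: z.1]).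
  exact: measurable_cons.
have mslice dd (S : measurableType dd) (f : S -> T2) (t : n.-tuple T2) :
    measurable_fun setT f -> measurable_fun setT (fun y => Phi [tuple of f y :: t]).
  by move=> mf; apply: (measurableT_comp mPhi); exact: measurable_cons.
(* Averaging the head out of [Phi] leaves a function of the remaining [pi] values only, to which the
   induction hypothesis applies. *)
pose Psi (t : n.-tuple T2) : \bar R := \int[P]_x Phi [tuple of pi x :: t].
have mPsi : measurable_fun setT Psi.
  apply: (measurable_fun_fubini_tonelli_F (fun z : n.-tuple T2 * T1 => Phi [tuple of pi z.2 :: z.1])) => //.
  exact: measurableT_comp.
have Psi0 t : 0 <= Psi t by exact: integral_ge0.
rewrite !ge0_integral_iidS//; last 2 first.
  by apply: emeasurable_funM => //; apply/measurable_EFinP; exact: mprod.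
  by move=> s; rewrite mule_ge0// lee_fin prodr_ge0.
pose W (s : n.-tuple T1) := (\prod_(i < n) w (lift ord0 i) (tnth s i))%R.
have mW : measurable_fun setT W by exact: (mprod _ (fun i => w (lift ord0 i))).
have W0 s : (0 <= W s)%R by exact: prodr_ge0.
have mPsiW : measurable_fun setT
    (fun s : n.-tuple T1 => Psi [tuple of map pi s] * (W s)%:E).
  apply: emeasurable_funM; last exact/measurable_EFinP.
  by apply: (measurableT_comp mPsi); exact: measurable_map_tuple.
apply: (@le_trans _ _ (\int[iid P n]_s ((rho ord0)%:E * (Psi [tuple of map pi s] * (W s)%:E)))).
  apply: ge0_le_integral => //.
  - move=> s _; apply: integral_ge0 => x _.
    by rewrite mule_ge0// lee_fin prodr_ge0.
  - apply: (measurable_fun_fubini_tonelli_F (fun z : n.-tuple T1 * T1 =>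
      Phi [tuple of map pi [tuple of z.2 :: z.1]] *
      (\prod_(i < n.+1) w i (tnth [tuple of z.2 :: z.1] i))%:E)).
    + apply: emeasurable_funM.
        exact: (measurableT_comp mPhi' mcons1).
      by apply/measurable_EFinP; exact: (measurableT_comp (mprod _ w mw) mcons1).
    + by move=> z; rewrite mule_ge0// lee_fin prodr_ge0.
  - exact: measurable_funeM mPsiW.
  - move=> s _.
    under eq_integral.
      move=> x _; rewrite cons_map big_ord_recl tnth0.
      under eq_bigr do rewrite tnthS.
      rewrite -/(W s) EFinM muleA.
      over.
    rewrite /= ge0_integralZr//.
    + rewrite muleA lee_wpmul2r// ?lee_fin//.
      apply: (wrho ord0 (fun y => Phi [tuple of y :: [tuple of map pi s]])) => //.
      exact: (mslice _ _ id).
    + apply: emeasurable_funM; last exact/measurable_EFinP.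
      exact: mslice.
    + by move=> x _; rewrite mule_ge0// lee_fin.
    + by rewrite lee_fin.
rewrite ge0_integralZl//; last 2 first.
  by move=> s _; rewrite mule_ge0// lee_fin.
  by rewrite lee_fin.
rewrite big_ord_recl EFinM -muleA lee_wpmul2l ?lee_fin//.
under [X in _ <= _ * X]eq_integral do under eq_integral do rewrite cons_map.
apply: (IH (fun i => w (lift ord0 i)) (fun i => rho (lift ord0 i)) _ _ _ _ Psi) => // i phi;
  exact: wrho.
Qed.

End product_weights.

Lemma ge0_integral_mrestr (R : realType) d (T : measurableType d)
    (mu : {measure set T -> \bar R}) (D : set T) (mD : measurable D) (f : T -> \bar R) :
  measurable_fun setT f -> (forall x, 0 <= f x)%E ->
  (\int[mrestr mu mD]_x f x = \int[mu]_x (f x * (\1_D x)%:E))%E.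
Proof.
move=> mf f0; apply: ge0_integral_density => // A mA.
by rewrite integral_indic//= setIC.
Qed.

(** * The label given the covariate *)

Section joint_law.
Context (R : realType) (d : nat).
Local Notation point := (euclid R d).
Variable P : joint_law R d.

Definition label_prob (b : bool) (x : point) : R :=
  if b then eta P x else 1 - eta P x.

Lemma label_prob_ge0 b x : 0 <= label_prob b x.
Proof.
by have [_ /(_ x)/andP[e0 e1] _] := eta_regression P; case: b; rewrite /label_prob// subr_ge0.
Qed.

Lemma label_probN b x : label_prob (~~ b) x = 1 - label_prob b x.
Proof. by case: b => //=; rewrite opprB addrC subrK. Qed.

Lemma measurable_label_prob b : measurable_fun setT (label_prob b).
Proof.
by have [me _ _] := eta_regression P; case: b => //; exact: measurable_funB.
Qed.

Lemma label_prob_le1 b x : label_prob b x <= 1.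
Proof. by rewrite -subr_ge0 -label_probN label_prob_ge0. Qed.

(** For the label [true] this is the defining property of the regression function; for [false], the
    two labels share out the finite marginal mass of [A], and the first case is subtracted. *)
Lemma law_label (b : bool) A : measurable A ->
  (law P (A `*` [set b]) = \int[marginal P]_(x in A) (label_prob b x)%:E)%E.
Proof.
move=> mA; have [me e01 eE] := eta_regression P.
case: b; first exact: eE.
have mAb b : measurable (A `*` [set b] : set (point * bool)) by exact: measurableX.
have : (law P (A `*` [set false]) + law P (A `*` [set true]) =
    \int[marginal P]_(x in A) (label_prob false x)%:E + law P (A `*` [set true]))%E.
  rewrite -measureU//; last first.
    by apply/seteqP; split => // -[x y] [/= [_ ->] [_]].
  rewrite eE// -ge0_integralD//.
  - under eq_integral do rewrite -EFinD subrK.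
    rewrite integral_cst// mul1e /marginal /distribution /pushforward/=.
    congr (law P _); apply/seteqP; split => [[x y]/= [[]|[]]//|[x [|]] /=]; by [left|right].
  - by move=> x _; rewrite lee_fin label_prob_ge0.
  - by apply: measurable_funTS; apply/measurable_EFinP; exact: measurable_label_prob.
  - by move=> x _; rewrite lee_fin; have /andP[] := e01 x.
  - by apply: measurable_funTS; exact/measurable_EFinP.
by move/(congr1 (fun u => u - law P (A `*` [set true]))%E); rewrite !addeK// fin_num_measure.
Qed.

(** By [law_label], the law restricted to the label [b] and pushed to the covariates has density
    [label_prob b] with respect to the marginal. *)
Lemma ge0_integral_label (b : bool) (phi : point -> \bar R) :
  measurable_fun setT phi -> (forall x, 0 <= phi x)%E ->
  (\int[law P]_z (phi z.1 * (z.2 == b)%:R%:E) =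
   \int[marginal P]_x (phi x * (label_prob b x)%:E))%E.
Proof.
move=> mphi phi0.
have mD : measurable (setT `*` [set b] : set (point * bool)) by exact: measurableX.
have mphi1 : measurable_fun setT (fun z : point * bool => phi z.1).
  exact: measurableT_comp.
transitivity (\int[pushforward (mrestr (law P) mD) fst]_x phi x)%E.
  rewrite ge0_integral_pushforward// preimage_setT ge0_integral_mrestr//.
  - apply: eq_integral => z _; congr (_ * _%:E)%E.
    rewrite indicE; congr (nat_of_bool _)%:R.
    by apply/eqP/idP => [zb|/set_mem[]//]; apply/mem_set.
  - by move=> z; exact: phi0.
apply: (@ge0_integral_density _ _ _ (pushforward (mrestr (law P) mD) fst)) => //.
- exact: measurable_label_prob.
- exact: label_prob_ge0.
move=> A mA; rewrite -law_label// /pushforward/= /mrestr; congr (law P _).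
by apply/seteqP; split => -[x y] /=; [case=> ? [] | case=> ? ?; split].
Qed.

(* On the samples whose neighbors all lie in G, exp (- t * vote b) is the
   product of the tilts of the neighbors. *)
Definition tilt (G : set point) (b : bool) (t : R) (z : point * bool) : R :=
  \1_G z.1 * (if z.2 == b then expR (- t) else expR t).

Lemma tilt_ge0 G b t z : 0 <= tilt G b t z.
Proof. by rewrite mulr_ge0//; case: ifP => _; exact: expR_ge0. Qed.

Lemma measurable_tilt G b t : measurable G -> measurable_fun setT (tilt G b t).
Proof.
move=> mG.
have m1 : measurable_fun setT (\1_G : point -> R) by exact: measurable_indic.
have m2 : measurable_fun setT (fun y : bool => if y == b then expR (- t) else expR t) by [].
by apply: measurable_funM; [exact: (measurableT_comp m1)|exact: (measurableT_comp m2)].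
Qed.

(** The moment generating function of one vote of bias at least [m]. Second-order bounds of the
    exponentials on [0,1] give [1 + 2 t^2 - 2 m t], and [1 + u <= exp u] does the rest. *)
Lemma tilt_mean (p t m : R) : 0 <= p <= 1 -> 0 <= t <= 1 -> 2^-1 + m <= p ->
  p * expR (- t) + (1 - p) * expR t <= expR (2 * t ^+ 2 - 2 * m * t).
Proof.
move=> /andP[p0 p1] /andP[t0 t1] pm.
have e0 : 0 < expR t by exact: expR_gt0.
have eN : expR (- t) <= 1 - t + t ^+ 2.
  rewrite expRN -div1r ler_pdivrMr//.
  have e1 := expR_ge1Dx t.
  apply: (@le_trans _ _ ((1 - t + t ^+ 2) * (1 + t))).
    by have := exprn_ge0 3 t0; nra.
  by apply: ler_wpM2l => //; nra.
have eP : expR t <= 1 + t + 2 * t ^+ 2.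
  have h1 : 1 - t / 2 <= expR (- (t / 2)) by have := expR_ge1Dx (- (t / 2)).
  have h2 : (1 - t / 2) ^+ 2 <= expR (- t).
    rewrite [in expR _](_ : t = t / 2 + t / 2); last by field.
    by rewrite opprD expRD expr2; apply: ler_pM => //; lra.
  have h3 : expR (- t) * expR t = 1 by rewrite -expRD addNr expR0.
  (* Four times the excess over 1 of the product in [h5]. *)
  have h4 : 0 <= (1 - t) * (5 - 2 * t) * t ^+ 2.
    by rewrite !mulr_ge0 ?sqr_ge0//; lra.
  have h5 : 1 <= (1 + t + 2 * t ^+ 2) * (1 - t / 2) ^+ 2 by nra.
  have h6 : 1 <= (1 + t + 2 * t ^+ 2) * expR (- t).
    by apply: (le_trans h5); apply: ler_wpM2l => //; nra.
  rewrite -[leLHS]mul1r; apply: (le_trans (ler_wpM2r (ltW e0) h6)).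
  by rewrite -mulrA h3 mulr1.
apply: le_trans (expR_ge1Dx _).
apply: (@le_trans _ _ (p * (1 - t + t ^+ 2) + (1 - p) * (1 + t + 2 * t ^+ 2))).
  by apply: lerD; apply: ler_wpM2l => //; rewrite subr_ge0.
by nra.
Qed.

(** The one-observation hypothesis of [integral_iid_prod_le] for the votes. As [phi] sees the
    covariate alone, the label can be averaged first: off [G] the tilt vanishes, and on [G], for
    almost every covariate, [tilt_mean] applies. *)
Lemma integral_tilt_le G Om b t m (phi : point -> \bar R) :
  measurable G -> measurable Om -> marginal P (~` Om) = 0%E ->
  0 <= t <= 1 -> (forall x, Om x -> G x -> 2^-1 + m <= label_prob b x) ->
  measurable_fun setT phi -> (forall x, 0 <= phi x)%E ->
  (\int[law P]_z (phi z.1 * (tilt G b t z)%:E)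
    <= (expR (2 * t ^+ 2 - 2 * m * t))%:E * \int[law P]_z phi z.1)%E.
Proof.
move=> mG mOm Om1 t01 Gm mphi phi0.
have mphiG : measurable_fun setT (fun x => phi x * (\1_G x)%:E)%E.
  by apply: emeasurable_funM => //; exact/measurable_EFinP.
have phiG0 x : (0 <= phi x * (\1_G x)%:E)%E by rewrite mule_ge0// lee_fin.
have mlab b' : measurable_fun setT (fun z : point * bool => (z.2 == b')%:R : R).
  have m2 : measurable_fun setT (fun y : bool => (y == b')%:R : R) by [].
  exact: (measurableT_comp m2).
have -> : (\int[law P]_z (phi z.1 * (tilt G b t z)%:E) =
   \int[marginal P]_x ((phi x * (\1_G x)%:E) *
   (label_prob b x * expR (- t) + (1 - label_prob b x) * expR t)%:E))%E.
  transitivity (\int[law P]_z ((expR (- t))%:E * (phi z.1 * (\1_G z.1)%:E * (z.2 == b)%:R%:E)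
     + (expR t)%:E * (phi z.1 * (\1_G z.1)%:E * (z.2 == ~~ b)%:R%:E)))%E.
    apply: eq_integral => z _; rewrite /tilt.
    by case: z.2; case: (b) => /=; rewrite EFinM ?mule0 ?adde0 ?add0e ?mule1 muleA muleC.
  have mphiz : measurable_fun setT (fun z : point * bool => phi z.1 * (\1_G z.1)%:E)%E.
    exact: (measurableT_comp mphiG).
  have mphil b' : measurable_fun setT
      (fun z : point * bool => phi z.1 * (\1_G z.1)%:E * (z.2 == b')%:R%:E)%E.
    by apply: emeasurable_funM => //; exact/measurable_EFinP.
  have phil0 b' (z : point * bool) : (0 <= phi z.1 * (\1_G z.1)%:E * (z.2 == b')%:R%:E)%E.
    by rewrite mule_ge0// lee_fin.
  have e0 (u : R) : (0 <= (expR u)%:E)%E by rewrite lee_fin expR_ge0.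
  rewrite ge0_integralD//; last 4 first.
  - by move=> z _; exact: mule_ge0.
  - exact: measurable_funeM.
  - by move=> z _; exact: mule_ge0.
  - exact: measurable_funeM.
  rewrite !ge0_integralZl// !(ge0_integral_label _ mphiG)//.
  have mlp b' : measurable_fun setT (fun x => phi x * (\1_G x)%:E * (label_prob b' x)%:E)%E.
    by apply: emeasurable_funM => //; apply/measurable_EFinP; exact: measurable_label_prob.
  have lp0 b' x : (0 <= phi x * (\1_G x)%:E * (label_prob b' x)%:E)%E.
    by rewrite mule_ge0// lee_fin label_prob_ge0.
  rewrite -!ge0_integralZl// -ge0_integralD//; last 4 first.
  - by move=> z _; exact: mule_ge0.
  - exact: measurable_funeM.
  - by move=> z _; exact: mule_ge0.
  - exact: measurable_funeM.
  apply: eq_integral => x _.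
  rewrite -label_probN EFinD ge0_muleDr ?lee_fin ?mulr_ge0 ?expR_ge0 ?label_prob_ge0//.
  by congr (_ + _)%E; rewrite EFinM [RHS]muleA muleC.
have -> : (\int[law P]_z phi z.1 = \int[marginal P]_x phi x)%E.
  rewrite /marginal ge0_integral_distribution//.
rewrite -ge0_integralZl ?lee_fin ?expR_ge0//.
apply: ae_ge0_le_integral => //.
- move=> x _; rewrite mule_ge0// lee_fin addr_ge0// mulr_ge0 ?expR_ge0 ?label_prob_ge0//.
  by rewrite subr_ge0 label_prob_le1.
- apply: emeasurable_funM => //; apply/measurable_EFinP.
  have := measurable_label_prob b => ml.
  by apply: measurable_funD; apply: measurable_funM => //; exact: measurable_funB.
- by move=> x _; rewrite mule_ge0// lee_fin expR_ge0.
- exact: measurable_funeM.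
exists (~` Om); split => //; first exact: measurableC.
apply: subsetC => x Omx _ /=.
rewrite -muleA [leRHS]muleC; apply: lee_wpmul2l => //; rewrite -EFinM lee_fin indicE.
have [/set_mem Gx|_] := boolP (x \in G); last by rewrite mul0r expR_ge0.
rewrite mul1r; apply: tilt_mean => //; last exact: Gm.
by rewrite label_prob_ge0 label_prob_le1.
Qed.

End joint_law.

(** * Nearest neighbors *)

(** A condition that depends on [z] only through finitely many measurable bits is a finite union of
    fibers of [g]. *)
Lemma measurable_finite_fiber d (T : measurableType d) (I : finType)
    (g : T -> {ffun I -> bool}) (f : T -> bool) :
  (forall i, measurable [set z | g z i]) ->
  (forall z z', g z = g z' -> f z = f z') -> measurable [set z | f z].
Proof.
move=> mg gf.
have mfib c : measurable [set z | g z = c].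
  rewrite (_ : [set z | _] = \bigcap_(i in [set: I]) [set z | g z i = c i]); last first.
    apply/seteqP; split => [z /= gz i _|z /= H]; first by rewrite /= gz.
    by apply/ffunP => i; exact: H.
  apply: fin_bigcap_measurable => [|i _]; first exact: finite_finset.
  case: (c i); first exact: mg.
  rewrite (_ : [set z | _] = ~` [set z | g z i]); first exact/measurableC/mg.
  by apply/seteqP; split => z /=; case: (g z i) => //; case.
rewrite (_ : [set z | f z] = \bigcup_(c in [set c | exists2 z, f z & g z = c]) [set z | g z = c]).
  by apply: fin_bigcup_measurable => // ; exact: finite_finset.
apply/seteqP; split => [z fz|z [c [z' fz' <-] /= gz]].
  by exists (g z) => //; exists z.
by rewrite (gf _ _ gz).
Qed.

Section nearest_neighbors.
Context (R : realType) (d n : nat).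
Local Notation point := (euclid R d).
Local Notation obs := (point * bool)%type.
Implicit Types (s : n.-tuple obs) (x : point) (X : n.-tuple point).

Lemma measurable_edist e (T : measurableType e) (f g : T -> point) :
  measurable_fun setT f -> measurable_fun setT g ->
  measurable_fun setT (fun z => edist (f z) (g z)).
Proof.
move=> mf mg.
have msq : measurable_fun setT (Num.sqrt : R -> R).
  by apply: continuous_measurable_fun; exact: sqrt_continuous.
apply: (measurableT_comp msq).
apply: measurable_sum => i; apply: measurable_funX; apply: measurable_funB.
  exact: (measurableT_comp (measurable_tnth i) mf).
exact: (measurableT_comp (measurable_tnth i) mg).
Qed.

(* The ranking of the sample by distance to x depends on the covariates only
   through this element of a finite type; measurability and the conditioning on
   the ranking both rest on it. *)
Definition dist_pattern X x : {ffun 'I_n * 'I_n -> bool} :=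
  [ffun ij => edist (tnth X ij.1) x <= edist (tnth X ij.2) x].

(** Indices are sorted instead of observations, so that the ranking is a function of the pattern
    alone. *)
Definition nn_index (p : {ffun 'I_n * 'I_n -> bool}) : seq 'I_n :=
  sort (fun i j => p (i, j)) (enum 'I_n).

Definition covariates s : n.-tuple point := [tuple of map fst s].

Definition neighbors k s x := take k (nn_index (dist_pattern (covariates s) x)).

(** The sample is the image of the enumeration of its indices, and sorting commutes with this map,
    ties included. *)
Lemma nn_labelE s x i : nn_label s x i =
  nth false [seq (tnth s j).2 | j <- nn_index (dist_pattern (covariates s) x)] i.-1.
Proof.
rewrite /nn_label; congr (nth _ _ _).
rewrite -[in LHS](map_tnth_enum s) sort_map -map_comp.
congr map; congr sort; apply/funext => a; apply/funext => b.
by rewrite /= ffunE /= !tnth_map.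
Qed.

Lemma size_nn_index p : size (nn_index p) = n.
Proof. by rewrite size_sort size_enum_ord. Qed.

Lemma uniq_nn_index p : uniq (nn_index p).
Proof. by rewrite sort_uniq enum_uniq. Qed.

Lemma size_neighbors k s x : (k <= n)%N -> size (neighbors k s x) = k.
Proof. by move=> kn; rewrite size_takel// size_nn_index. Qed.

(** Signs instead of 0/1 labels: the opposite label gets the opposite vote, and the exponential of a
    vote is a product over the neighbors. *)
Definition vote (b : bool) k s x : R :=
  \sum_(j <- neighbors k s x) (if (tnth s j).2 == b then 1 else -1).

Lemma voteN b k s x : vote (~~ b) k s x = - vote b k s x.
Proof.
rewrite /vote -sumrN; apply: eq_bigr => j _.
by case: (tnth s j).2; case: b => //=; rewrite opprK.
Qed.

Lemma knn_etaE k s x : (1 <= k <= n)%N ->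
  knn_eta k s x - 2^-1 = vote true k s x / (2 * k%:R).
Proof.
move=> /andP[k0 kn].
have k0' : k%:R != 0 :> R by rewrite pnatr_eq0 -lt0n.
have -> : vote true k s x = 2 * (knn_eta k s x * k%:R) - k%:R; last by field.
rewrite /knn_eta divfK// big_add1/=.
rewrite (_ : \sum_(0 <= i < k) _ = \sum_(j <- neighbors k s x) ((tnth s j).2 : nat)%:R); last first.
  rewrite -(big_map (fun j => (tnth s j).2) xpredT (fun y : bool => (y : nat)%:R)).
  rewrite (big_nth false) size_map size_neighbors//.
  apply: eq_big_nat => i /andP[_ ik]; rewrite nn_labelE /= /neighbors map_take nth_take//.
have kE : k%:R = \sum_(j <- neighbors k s x) 1 :> R.
  by rewrite big_const_seq count_predT size_neighbors// iter_addr addr0.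
rewrite [X in _ - X]kE mulr_sumr -sumrB.
by apply: eq_bigr => j _; case: (tnth s j).2 => /=; ring.
Qed.

(** A tied vote is classified as [true]; the strict inequality makes the statement valid for both
    labels. *)
Lemma f_NN_vote b k s x : (1 <= k <= n)%N -> 0 < vote b k s x -> f_NN k s x = b.
Proof.
move=> kn; have k0 : 0 < (2 * k%:R)^-1 :> R.
  by rewrite invr_gt0 mulr_gt0// ltr0n; case/andP: kn.
rewrite /f_NN -subr_ge0 knn_etaE//; case: b => v0.
  by apply/ltW/mulr_gt0.
apply/negbTE; rewrite -ltNge pmulr_llt0//.
by rewrite -oppr_gt0 -voteN.
Qed.

Lemma signal_gtE b k s x tau : (1 <= k <= n)%N ->
  (tau < signal k s x) = (2 * tau * Num.sqrt k%:R < `|vote b k s x|).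
Proof.
move=> kn; have k0 : 0 < k%:R :> R by rewrite ltr0n; case/andP: kn.
have k1 : 0 < Num.sqrt k%:R :> R by rewrite sqrtr_gt0.
rewrite /signal knn_etaE// (_ : `|vote b k s x| = `|vote true k s x|); last first.
  by case: b => //; rewrite (voteN true) normrN.
rewrite normrM normfV [in `|_ * _|]gtr0_norm ?mulr_gt0//.
rewrite -{2}(sqr_sqrtr (ltW k0)).
rewrite (_ : _ * (_ / _) = `|vote true k s x| / (2 * Num.sqrt k%:R)); last first.
  by field; rewrite gt_eqF.
by rewrite ltr_pdivlMr ?mulr_gt0// mulrA [tau * 2]mulrC.
Qed.

(** The rule stops at some [kh <= ks], since [ks] passes the threshold. The vote at [kh] passes it
    as well in absolute value, and the hypothesis on all [k] up to [ks] excludes that it does so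
    with the wrong sign. *)
Lemma f_pa_vote b ks s x : let tau := threshold R d n in (1 <= ks <= n)%N -> 0 <= tau ->
  (forall k, (1 <= k <= ks)%N -> - (2 * tau * Num.sqrt k%:R) < vote b k s x) ->
  2 * tau * Num.sqrt ks%:R < vote b ks s x ->
  f_pa s x = b.
Proof.
move=> tau /andP[ks0 ksn] tau0 Hk Hks; rewrite /f_pa /k_adaptive -/tau.
set l := [seq _ <- _ | _].
have ksl : ks \in l.
  rewrite mem_filter mem_iota ks0 add1n ltnS ksn !andbT (signal_gtE b) ?ks0//.
  exact: lt_le_trans Hks (ler_norm _).
have sl : sorted ltn l by apply: sorted_filter; [exact: ltn_trans|exact: iota_ltn_sorted].
case El : l ksl sl => [//|kh l'] ksl sl /=.
have : kh \in l by rewrite El mem_head.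
rewrite mem_filter mem_iota add1n ltnS => /andP[skh /andP[kh0 khn]].
have khks : (kh <= ks)%N.
  move: ksl; rewrite inE => /orP[/eqP->//|].
  move: sl => /= /(order_path_min ltn_trans)/allP H /H/ltnW//.
have := skh; rewrite (signal_gtE b) ?kh0// => vk.
apply: f_NN_vote; rewrite ?kh0//.
have hk := Hk kh; rewrite kh0 khks in hk; have {}hk := hk isT.
have h0 : 0 <= 2 * tau * Num.sqrt kh%:R by rewrite !mulr_ge0 ?sqrtr_ge0.
move: vk; rewrite ltr_normr => /orP[/(le_lt_trans h0)//|].
by rewrite ltrNr => /(lt_trans hk); rewrite ltxx.
Qed.

Definition ball_count r s x : nat := \sum_(i < n) (edist (tnth s i).1 x <= r)%R.

(** Past a neighbor farther than [r], all later ones are farther than [r] too; if one of the first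
    [k] were that far, fewer than [k] observations would lie in the ball. *)
Lemma neighbors_close k s x r : (k <= n)%N ->
  (k <= ball_count r s x)%N ->
  forall j, j \in neighbors k s x -> edist (tnth s j).1 x <= r.
Proof.
move=> kn kr j jk.
rewrite leNgt; apply/negP => rj.
have {jk}[ij]: exists2 i, (i < k)%N & nth j (nn_index (dist_pattern (covariates s) x)) i = j.
  move: jk => /(nthP j)[i]; rewrite size_neighbors// => ik ji; exists i => //.
  by rewrite -[RHS]ji nth_take.
set l := nn_index _ => ijk lj.
have sl : sorted (fun i i' => dist_pattern (covariates s) x (i, i')) l.
  apply: sort_sorted => a c; by rewrite !ffunE /= le_total.
have : (\sum_(i < n) (edist (tnth s i).1 x <= r)%R < k)%N.
  apply: leq_ltn_trans (ijk).
  have pl : perm_eq (index_enum 'I_n) l.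
    apply: uniq_perm => [||i]; rewrite ?index_enum_uniq ?uniq_nn_index//.
    by rewrite mem_index_enum mem_sort mem_enum.
  rewrite (perm_big _ pl)/=.
  (* The ranking is cut at the far neighbor: the part before it has at most [ij] elements, and the
     rest contributes 0. *)
  rewrite -(cat_take_drop ij l) big_cat/= [X in (_ + X)%N]big1_seq ?addn0.
    apply: (@leq_trans (\sum_(i <- take ij l) 1)); first by apply: leq_sum => i _; case: (_ <= _).
    by rewrite sum1_size size_take; case: ifP => // /negbT; rewrite -leqNgt.
  move=> i /andP[_ /(nthP j)[a]]; rewrite size_drop => al <-.
  apply/eqP; rewrite eqb0 -ltNge; apply: (lt_le_trans rj).
  rewrite nth_drop.
  have := @sorted_leq_nth _ (fun i i' => dist_pattern (covariates s) x (i, i')) _ _ j l sl ij (ij + a)%N.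
  rewrite !inE lj ffunE /= !tnth_map; apply.
  - by move=> a1 a2 a3; rewrite !ffunE; exact: le_trans.
  - by move=> a1; rewrite ffunE.
  - by rewrite size_nn_index (leq_trans ijk).
  - by rewrite -ltn_subRL.
  - exact: leq_addr.
by rewrite ltnNge kr.
Qed.

(** All that the classifiers see of the sample and the query point, as finitely many bits; their
    joint measurability follows from [measurable_finite_fiber]. *)
Definition nn_data (z : n.-tuple obs * point) : {ffun 'I_n * 'I_n + 'I_n -> bool} :=
  [ffun i => match i with
             | inl ij => dist_pattern (covariates z.1) z.2 ij
             | inr j => (tnth z.1 j).2 end].

Lemma measurable_dist_pattern ij :
  measurable [set z : n.-tuple point * point | dist_pattern z.1 z.2 ij].
Proof.
rewrite (_ : [set z | _] = [set: n.-tuple point * point] `&`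
   (fun z => edist (tnth z.1 ij.1) z.2 <= edist (tnth z.1 ij.2) z.2) @^-1` [set true]).
  have mt i : measurable_fun setT (fun z : n.-tuple point * point => tnth z.1 i).
    exact: (measurableT_comp (measurable_tnth i)).
  by apply: measurable_fun_ler => //; apply: measurable_edist.
by rewrite setTI; apply/seteqP; split => z /=; rewrite ffunE.
Qed.

Lemma measurable_covariates : measurable_fun setT covariates.
Proof. exact: measurable_map_tuple. Qed.

Lemma measurable_nn_data i : measurable [set z | nn_data z i].
Proof.
case: i => [ij|j].
  have mc : measurable_fun setT (fun z : n.-tuple obs * point => (covariates z.1, z.2)).
    by apply: measurable_fun_pair => //; exact: (measurableT_comp measurable_covariates).
  have := mc measurableT _ (measurable_dist_pattern ij); rewrite setTI.
  by congr measurable; apply/seteqP; split => z /=; rewrite !ffunE.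
have mt : measurable_fun setT (fun z : n.-tuple obs * point => (tnth z.1 j).2).
  exact: (measurableT_comp measurable_snd (measurableT_comp (measurable_tnth j) measurable_fst)).
have := mt measurableT [set true]; rewrite setTI => /(_ I).
by congr measurable; apply/seteqP; split => z /=; rewrite !ffunE.
Qed.

Lemma nn_data_label z z' : nn_data z = nn_data z' -> nn_label z.1 z.2 = nn_label z'.1 z'.2.
Proof.
move=> /ffunP zz; apply/funext => i; rewrite !nn_labelE.
have -> : dist_pattern (covariates z.1) z.2 = dist_pattern (covariates z'.1) z'.2.
  by apply/ffunP => ij; have := zz (inl ij); rewrite ![nn_data _ _]ffunE.
congr (nth _ _ _); apply: eq_map => j.
by have := zz (inr j); rewrite ![nn_data _ _]ffunE.
Qed.

Lemma nn_data_knn_eta z z' : nn_data z = nn_data z' ->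
  forall k, knn_eta k z.1 z.2 = knn_eta k z'.1 z'.2.
Proof. by move=> zz k; rewrite /knn_eta (nn_data_label zz). Qed.

Lemma measurable_f_NN k : measurable [set z : n.-tuple obs * point | f_NN k z.1 z.2].
Proof.
apply: (measurable_finite_fiber measurable_nn_data) => z z' zz.
by rewrite /f_NN (nn_data_knn_eta zz).
Qed.

Lemma measurable_f_pa : measurable [set z : n.-tuple obs * point | f_pa z.1 z.2].
Proof.
apply: (measurable_finite_fiber measurable_nn_data) => z z' zz.
rewrite /f_pa (nn_data_knn_eta zz) (_ : k_adaptive z.1 z.2 = k_adaptive z'.1 z'.2)//.
congr head; apply: eq_filter => k.
by rewrite /signal (nn_data_knn_eta zz).
Qed.

Lemma measurable_pair_cst d1 d2 (T1 : measurableType d1) (T2 : measurableType d2)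
    (A : set (T1 * T2)) (x : T2) : measurable A -> measurable [set s | A (s, x)].
Proof.
move=> mA; have mp : measurable_fun setT (fun s : T1 => (s, x)).
  exact: measurable_fun_pair.
by have := mp measurableT _ mA; rewrite setTI.
Qed.

Lemma measurable_vote_le b k a x : measurable [set s | vote b k s x <= a].
Proof.
apply: (@measurable_pair_cst _ _ _ _ [set z | vote b k z.1 z.2 <= a]).
apply: (measurable_finite_fiber measurable_nn_data) => z z' /ffunP zz.
rewrite /vote /neighbors.
have -> : dist_pattern (covariates z.1) z.2 = dist_pattern (covariates z'.1) z'.2.
  by apply/ffunP => ij; have := zz (inl ij); rewrite ![nn_data _ _]ffunE.
congr (_ <= _); apply: eq_bigr => j _.
by have := zz (inr j); rewrite ![nn_data _ _]ffunE => ->.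
Qed.

Lemma measurable_ball_count_ge k r x : measurable [set s | (k <= ball_count r s x)%N].
Proof.
apply: (@measurable_finite_fiber _ _ _ (fun s => [ffun i : 'I_n => edist (tnth s i).1 x <= r])).
  move=> i; rewrite (_ : [set s | _] = [set: n.-tuple obs] `&`
      (fun s => edist (tnth s i).1 x <= r) @^-1` [set true]); last first.
    by rewrite setTI; apply/seteqP; split => z /=; rewrite ffunE.
  apply: measurable_fun_ler => //; apply: measurable_edist => //.
  exact: (measurableT_comp measurable_fst (measurable_tnth i)).
move=> s s' /ffunP ss; congr (_ <= _)%N; apply: eq_bigr => i _.
by have := ss i; rewrite !ffunE => ->.
Qed.

End nearest_neighbors.

(** * Concentration *)

(** Markov's inequality in the form used by both Chernoff bounds. *)
Lemma le_measure_integral (R : realType) d (T : measurableType d)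
    (mu : {measure set T -> \bar R}) (E : set T) (f : T -> \bar R) :
  measurable E -> measurable_fun setT f -> (forall s, 0 <= f s)%E ->
  (forall s, E s -> 1 <= f s)%E -> (mu E <= \int[mu]_s f s)%E.
Proof.
move=> mE mf f0 Ef; rewrite -[E in leLHS]setIT -integral_indic//.
apply: ge0_le_integral => //.
- exact/measurable_EFinP.
move=> s _; rewrite indicE.
by have [/set_mem/Ef|_] := boolP (s \in E); [|exact: f0].
Qed.

Section concentration.
Context (R : realType) (d : nat).
Local Notation point := (euclid R d).
Variable P : joint_law R d.

Lemma edistC (x y : point) : edist x y = edist y x.
Proof.
by rewrite /edist; congr Num.sqrt; apply: eq_bigr => i _; rewrite -sqrrN opprB.
Qed.

Lemma measurable_eball (x : point) r : measurable (eball x r).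
Proof.
have mf : measurable_fun setT (fun y => edist x y <= r).
  by apply: measurable_fun_ler => //; exact: measurable_edist.
have := mf measurableT [set true] Logic.I; rewrite setTI.
by congr measurable; apply/seteqP; split.
Qed.

(** Chernoff bound at tilt 1: the mean of [exp (- ball_count)] is at most [exp (- n p / 2)], and
    [k - n p / 2 <= - k]. *)
Lemma ball_count_tail (x : point) r k n (p : R) :
  marginal P (eball x r) = p%:E -> 4 * k%:R <= n%:R * p ->
  (iid (law P) n [set s | ~ (k <= ball_count r s x)%N] <= (expR (- k%:R))%:E)%E.
Proof.
move=> Bp kp.
pose B : set (point * bool) := fst @^-1` (eball x r).
have mB : measurable B.
  by rewrite -[B]setTI; apply: (measurable_fst measurableT); exact: measurable_eball.
have PB : law P B = p%:E by [].
have PC : law P (~` B) = (1 - p)%:E by rewrite probability_setC// PB.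
have p0 : 0 <= p by rewrite -lee_fin -PB.
have p1 : p <= 1 by rewrite -lee_fin -PB probability_le1.
(* [w] is [exp (- \1_B)] in affine form; its mean [1 - (1 - exp (-1)) p] is at most [exp (- p / 2)]
   because [exp (-1) <= 1/2]. *)
pose w (z : point * bool) : R := 1 - (1 - expR (- 1)) * \1_B z.
have e2 : expR (- 1) <= 2^-1 :> R.
  rewrite expRN lef_pV2 ?posrE ?expR_gt0//.
  by have := expR_ge1Dx (1 : R).
have e0 : 0 <= expR (- 1) :> R := expR_ge0 _.
have w0 z : 0 <= w z.
  by rewrite /w indicE; case: (z \in B); rewrite ?mulr1 ?mulr0; lra.
have mw : measurable_fun setT w.
  apply: measurable_funB => //; apply: measurable_funM => //.
have wint : (\int[law P]_z (w z)%:E <= (expR (- (p / 2)))%:E)%E.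
  have -> : (\int[law P]_z (w z)%:E = (expR (- 1) * p + (1 - p))%:E)%E.
    transitivity (\int[law P]_z ((expR (- 1))%:E * (\1_B z)%:E + (\1_(~` B) z)%:E))%E.
      apply: eq_integral => z _; rewrite /w -EFinM -EFinD indicC indicE; congr EFin.
      by case: (z \in B) => /=; ring.
    rewrite ge0_integralD//; last 2 first.
    - by apply: measurable_funeM; apply/measurable_EFinP.
    - by apply/measurable_EFinP; apply: measurable_indic; exact: measurableC.
    rewrite ge0_integralZl//; last exact/measurable_EFinP.
    rewrite !integral_indic// ?setIT; last exact: measurableC.
    rewrite [X in (_ * X)%E](_ : _ = p%:E)//.
    by rewrite [X in (_ + X)%E](_ : _ = (1 - p)%:E).
  rewrite lee_fin; apply: le_trans (expR_ge1Dx _); nra.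
pose f (s : n.-tuple (point * bool)) : R := \prod_(i < n) w (tnth s i).
have mf : measurable_fun setT f.
  apply: measurable_prod => i _; exact: (measurableT_comp mw (measurable_tnth i)).
have f0 s : 0 <= f s by exact: prodr_ge0.
have fE s : f s = expR (- (ball_count r s x)%:R).
  rewrite /f /ball_count natr_sum -sumrN expR_sum; apply: eq_bigr => i _.
  rewrite /w indicE; have -> : (tnth s i \in B) = (edist (tnth s i).1 x <= r).
    by apply/idP/idP => [/set_mem|?]; [|apply/mem_set]; rewrite /B /eball/= edistC.
  by case: (_ <= _) => /=; rewrite ?oppr0 ?expR0; ring.
apply: (@le_trans _ _ (\int[iid (law P) n]_s ((expR k%:R)%:E * (f s)%:E))%E).
  apply: le_measure_integral.
  - have := measurableC (measurable_ball_count_ge (n := n) k r x).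
    by [].
  - by apply: measurable_funeM; apply/measurable_EFinP.
  - by move=> s; rewrite mule_ge0// lee_fin ?expR_ge0.
  - move=> s /= /negP; rewrite -ltnNge => /ltnW ck.
    by rewrite -EFinM lee_fin fE -expRD -[leLHS]expR0 ler_expR subr_ge0 ler_nat.
rewrite ge0_integralZl//; last 2 first.
- exact/measurable_EFinP.
- by move=> s _; rewrite lee_fin.
have := @integral_iid_prod_le R _ _ _ _ (law P) (fun=> 0%N) (measurable_cst _) n
  (fun=> w) (fun=> expR (- (p / 2))) (fun=> mw) (fun=> w0) (fun=> expR_ge0 _).
move=> /(_ _ (cst 1%E)) H.
have {H} : (\int[iid (law P) n]_s (f s)%:E <= (expR (- (p / 2) * n%:R))%:E)%E.
  apply: (le_trans (y := _)); last apply: (le_trans (H _ _ _)) => //.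
  - by under [leRHS]eq_integral do rewrite /= mul1e.
  - move=> i phi mphi phi0.
    rewrite ge0_integralZl//; [|exact/measurable_EFinP|by move=> ? _; rewrite lee_fin].
    rewrite integral_cst// [X in (_ * (_ * X))%E](_ : _ = 1%E); last exact: probability_setT.
    by rewrite mule1 muleC; exact: lee_wpmul2r.
  rewrite /= integral_cst// mul1e [X in (_ * X)%E](_ : _ = 1%E); last exact: probability_setT.
  by rewrite mule1 lee_fin prodr_const card_ord -expRM_natr.
move=> H; apply: le_trans (lee_wpmul2l _ H) _; first by rewrite lee_fin expR_ge0.
by rewrite -EFinM lee_fin -expRD ler_expR; nra.
Qed.

(** Chernoff bound at tilt [t], one ranking at a time. For a fixed ranking the set of neighbors is
    fixed and the moment costs a factor [rho] per neighbor; the rankings partition the samples, so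
    their number does not enter. [k'] is kept apart from [k] so that a single ball count event
    serves the votes of all [k] up to [k']. *)
Lemma vote_tail Om (x : point) r b k k' n (t m a : R) :
  measurable Om -> marginal P (~` Om) = 0%E -> (k <= k' <= n)%N -> 0 <= t <= 1 ->
  (forall y, Om y -> edist y x <= r -> 2^-1 + m <= label_prob P b y) ->
  (iid (law P) n [set s | (k' <= ball_count r s x)%N /\ (vote b k s x <= a)%R]
     <= (expR (t * a + k%:R * (2 * t ^+ 2 - 2 * m * t)))%:E)%E.
Proof.
move=> mOm Om1 /andP[kk' k'n] t01 Pm.
have kn := leq_trans kk' k'n.
have /andP[t0 _] := t01.
have mB := measurable_eball x r.
pose F := {ffun 'I_n * 'I_n -> bool}.
pose S (p : F) : seq 'I_n := take k (nn_index p).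
have uS p : uniq (S p) by rewrite take_uniq// uniq_nn_index.
pose w (p : F) (i : 'I_n) z := if i \in S p then tilt (eball x r) b t z else 1.
have w0 p i z : 0 <= w p i z by rewrite /w; case: ifP => // _; exact: tilt_ge0.
have mw p i : measurable_fun setT (w p i).
  rewrite /w; case: (i \in S p) => //; exact: measurable_tilt.
pose rho := expR (2 * t ^+ 2 - 2 * m * t).
pose Phi (p : F) (X : n.-tuple point) : \bar R := (\1_[set X | dist_pattern X x = p] X)%:E.
have mset p : measurable [set X : n.-tuple point | dist_pattern X x = p].
  have -> : [set X : n.-tuple point | dist_pattern X x = p] =
      [set X | dist_pattern X x == p] by apply/seteqP; split => X /eqP.
  apply: (@measurable_pair_cst _ _ _ _ [set z | dist_pattern z.1 z.2 == p]).
  by apply: (measurable_finite_fiber (measurable_dist_pattern (n := n))) => z z' ->.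
have mPhi p : measurable_fun setT (Phi p).
  by apply/measurable_EFinP; exact: measurable_indic.
have Phi0 p X : (0 <= Phi p X)%E by rewrite lee_fin.
pose W p (s : n.-tuple (point * bool)) := \prod_(i < n) w p i (tnth s i).
have mW p : measurable_fun setT (W p).
  by apply: measurable_prod => i _; exact: (measurableT_comp (mw p i) (measurable_tnth i)).
have W0 p s : 0 <= W p s by exact: prodr_ge0.
have mPhic p : measurable_fun setT (fun s : n.-tuple (point * bool) => Phi p (covariates s)).
  by apply: measurableT_comp => //; exact: measurable_covariates.
have mPW p : measurable_fun setT (fun s => Phi p (covariates s) * (W p s)%:E)%E.
  by apply: emeasurable_funM => //; exact/measurable_EFinP.
have PW0 p s : (0 <= Phi p (covariates s) * (W p s)%:E)%E by rewrite mule_ge0// lee_fin.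
apply: (@le_trans _ _ (\int[iid (law P) n]_s ((expR (t * a))%:E *
    \sum_(p : F) (Phi p (covariates s) * (W p s)%:E)))%E).
  apply: le_measure_integral.
  - apply: measurableI; [exact: measurable_ball_count_ge|exact: measurable_vote_le].
  - by apply: measurable_funeM; exact: emeasurable_sum.
  - by move=> s; rewrite mule_ge0 ?lee_fin ?expR_ge0// sume_ge0.
  - move=> s [ks va].
    rewrite (bigD1 (dist_pattern (covariates s) x))//= [X in (_ + X)%E]big1 ?adde0; last first.
      move=> p pn; rewrite /Phi indicE memNset ?mul0e//= => ps.
      by rewrite ps eqxx in pn.
    rewrite /Phi indicE mem_set// mul1e -EFinM lee_fin.
    (* Enough observations lie in the ball, so [neighbors_close] makes every indicator in the tilts
       equal to 1. *)
    have -> : W (dist_pattern (covariates s) x) s = expR (- t * vote b k s x).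
      rewrite /W /w -big_mkcond -big_uniq//= /vote mulr_sumr expR_sum.
      rewrite big_seq [RHS]big_seq; apply: eq_bigr => j jS.
      rewrite /tilt indicE mem_set ?mul1r; last first.
        rewrite /eball/= edistC; apply: (@neighbors_close _ _ _ k s x r) => //.
        exact: leq_trans ks.
      by case: ifP; rewrite ?mulrN1 ?opprK ?mulr1.
    rewrite -expRD -[leLHS]expR0 ler_expR; nra.
rewrite ge0_integralZl//; last 2 first.
- exact: emeasurable_sum.
- by move=> s _; rewrite sume_ge0.
rewrite expRD EFinM lee_wpmul2l ?lee_fin ?expR_ge0//.
rewrite ge0_integral_sum//.
have rhok : expR (k%:R * (2 * t ^+ 2 - 2 * m * t)) = rho ^+ k.
  by rewrite -expRM_natr mulrC.
apply: (@le_trans _ _ (\sum_(p : F) ((rho ^+ k)%:E * \int[iid (law P) n]_s Phi p (covariates s)))%E).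
  apply: lee_sum => p _.
  have := @integral_iid_prod_le R _ _ _ _ (law P) fst measurable_fst n
    (w p) (fun i => if i \in S p then rho else 1).
  have -> : \prod_(i < n) (if i \in S p then rho else 1) = rho ^+ k.
    rewrite -big_mkcond -big_uniq//= big_const_seq count_predT.
    by rewrite /S size_takel ?size_nn_index// -Monoid.iteropE.
  apply => //.
  - by move=> i; case: ifP => // _; exact: expR_ge0.
  move=> i phi mphi phi0; rewrite /w; case: ifP => _; last first.
    by under eq_integral do rewrite mule1; rewrite mul1e.
  apply: (integral_tilt_le mB mOm) => // y Omy; rewrite /eball/= edistC; exact: Pm.
rewrite -ge0_sume_distrr; last by move=> p _; exact: integral_ge0.
rewrite -ge0_integral_sum// rhok.
rewrite -[leRHS]mule1; apply: lee_wpmul2l; first by rewrite lee_fin exprn_ge0// expR_ge0.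
(* The ranking indicators add up to 1 at every sample, so their total integral is at most 1. *)
rewrite -[leRHS](@probability_setT _ _ _ (iid (law P) n)) -[leRHS]mul1e -integral_cst//.
apply: ge0_le_integral => //.
- by move=> s _; rewrite sume_ge0.
- exact: emeasurable_sum.
move=> s _; rewrite (bigD1 (dist_pattern (covariates s) x))//= [X in (_ + X)%E]big1 ?adde0.
  by rewrite /Phi indicE lee_fin; case: (_ \in _).
move=> p pn; rewrite /Phi indicE memNset//= => ps.
by rewrite ps eqxx in pn.
Qed.

End concentration.

(** * Supports and ball masses *)

Section support.
Context (R : realType) (d : nat).
Local Notation point := (euclid R d).

(** The sharp constant is the square root of [d]; replacing it by [d] only changes constants further
    on. *)
Lemma edist_le_box (x y : point) (r : R) : 0 <= r ->
  (forall i, `|(tnth x i : R) - tnth y i| <= r) -> edist x y <= d%:R * r.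
Proof.
move=> r0 H; have dr : 0 <= d%:R * r by rewrite mulr_ge0.
rewrite -[leRHS]ger0_norm// -sqrtr_sqr ler_sqrt ?sqr_ge0//.
apply: (@le_trans _ _ (\sum_(i < d) r ^+ 2)).
  by apply: ler_sum => i _; rewrite -real_normK ?num_real// lerXn2r ?nnegrE.
rewrite sumr_const card_ord exprMn -[_ ^+ 2 *+ d]mulr_natl; apply: ler_wpM2r; first exact: sqr_ge0.
by rewrite -natrX ler_nat; case: (d) => // m; rewrite expnS expn1 leq_pmull.
Qed.

Lemma coord_le_edist (x y : point) i : `|(tnth x i : R) - tnth y i| <= edist x y.
Proof.
rewrite -sqrtr_sqr ler_sqrt; last by apply: sumr_ge0 => j _; exact: sqr_ge0.
by rewrite (bigD1 i)//= lerDl; apply: sumr_ge0 => j _; exact: sqr_ge0.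
Qed.

(* Open boxes, so that a point of a null box has a null ball around it. *)
Definition rat_box (c : d.-tuple rat * rat) : set point :=
  [set y | forall i, `|(tnth y i : R) - ratr (tnth c.1 i)| < ratr c.2].

Lemma measurable_rat_box c : measurable (rat_box c).
Proof.
rewrite (_ : rat_box c = \bigcap_(i in [set: 'I_d])
    [set y | `|(tnth y i : R) - ratr (tnth c.1 i)| < ratr c.2]); last first.
  by apply/seteqP; split => y H i //=; exact: H.
apply: fin_bigcap_measurable => [|i _]; first exact: finite_finset.
have mf : measurable_fun setT (fun y : point => `|(tnth y i : R) - ratr (tnth c.1 i)| < ratr c.2).
  apply: measurable_fun_ltr => //.
  apply: (@measurableT_comp _ _ _ _ _ _ (@Num.norm _ R)) => //.
  apply: measurable_funB => //.
  exact: (measurable_tnth i).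
have := mf measurableT [set true] Logic.I; rewrite setTI.
by congr measurable; apply/seteqP; split.
Qed.

Variable mu : probability point R.

Definition null_box (n : nat) : set point :=
  if unpickle n is Some c then
    if mu (rat_box c) == 0%E then rat_box c else set0
  else set0.

Lemma measurable_null_box n : measurable (null_box n).
Proof.
rewrite /null_box; case: unpickle => // c; case: ifP => // _; exact: measurable_rat_box.
Qed.

(** A point off the support has a null ball around it, hence lies in a null rational box, of which
    there are countably many. Both the measurability of the support and the nullity of its
    complement come from this identity. *)
Lemma msupportC : ~` msupport mu = \bigcup_n null_box n.
Proof.
apply/seteqP; split => [x xs|x [n _]]; last first.
  rewrite /null_box; case: unpickle => // c; case: ifP => // /eqP c0 xc xs.
  (* The least slack of [x] in the open box, capped at 1: the ball of radius [r / 2] around [x]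
     stays in the box, hence is null. *)
  pose r := \big[Num.min/1]_(i < d) (ratr c.2 - `|(tnth x i : R) - ratr (tnth c.1 i)|).
  have r0 : 0 < r.
    by apply/bigmin_gtP; split => // i _; rewrite subr_gt0; exact: xc.
  have r20 : 0 < r / 2 by rewrite divr_gt0.
  have := xs _ r20; apply/negP; rewrite -leNgt -c0.
  apply: le_measure; rewrite ?inE; [exact: measurable_eball|exact: measurable_rat_box|].
  move=> y /= xy i.
  have ri : r <= ratr c.2 - `|(tnth x i : R) - ratr (tnth c.1 i)| by exact: bigmin_le_cond.
  have xyi := le_trans (coord_le_edist x y i) xy.
  rewrite (_ : tnth y i - _ = (tnth x i - ratr (tnth c.1 i)) - ((tnth x i : R) - tnth y i));
    last by ring.
  by have := ler_normB ((tnth x i : R) - ratr (tnth c.1 i)) ((tnth x i : R) - tnth y i); lra.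
have [r r0 xr] : exists2 r, 0 < r & mu (eball x r) = 0%E.
  move: xs => /existsNP[r /not_implyP[r0 /negP]]; rewrite -leNgt => mr.
  by exists r => //; apply/eqP; rewrite eq_le mr measure_ge0.
(* Two points of a box of half-side [rho] are within [2 d rho] of each other; dividing by [d + 1]
   keeps the quotient positive for [d = 0]. *)
have d1 : 0 < (2 * d.+1%:R : R) by rewrite mulr_gt0.
have [rho /andP[rho0 rhor]] : exists rho : rat, 0 < (ratr rho : R) < r / (2 * d.+1%:R).
  have /rat_in_itvoo[q] : 0 < r / (2 * d.+1%:R) by rewrite divr_gt0.
  by rewrite in_itv/=; exists q.
have /choice[q Hq] : forall i : 'I_d, exists q : rat, `|(tnth x i : R) - ratr q| < ratr rho.
  move=> i; have /rat_in_itvoo[q] : (tnth x i : R) - ratr rho < (tnth x i : R) + ratr rho by lra.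
  rewrite in_itv/= => /andP[q1 q2]; exists q; rewrite ltr_norml; apply/andP; split; lra.
pose c := ([tuple q i | i < d], rho).
have cx : rat_box c `<=` eball x r.
  move=> y yc /=; have r2 : 0 <= 2 * ratr rho :> R by rewrite mulr_ge0// ltW.
  apply: (le_trans (@edist_le_box x y _ r2 _)).
    move=> i; have := yc i; rewrite tnth_mktuple/= => yi; have xi := Hq i.
    rewrite (_ : tnth x i - _ = ((tnth x i : R) - ratr (q i)) - ((tnth y i : R) - ratr (q i)));
      last by ring.
    by have := ler_normB ((tnth x i : R) - ratr (q i)) ((tnth y i : R) - ratr (q i)); lra.
  move: rhor; rewrite ltr_pdivlMr// => rhor.
  apply: le_trans (ltW rhor); rewrite mulrA mulrC [d%:R * 2]mulrC; apply: ler_wpM2l;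
    first exact: ltW.
  by rewrite ler_pM2l// ler_nat.
exists (pickle c) => //; rewrite /null_box pickleK.
have -> : mu (rat_box c) == 0%E.
  rewrite eq_le measure_ge0 andbT -xr; apply: le_measure; rewrite ?inE//.
    exact: measurable_rat_box.
  exact: measurable_eball.
by move=> i; rewrite tnth_mktuple; exact: Hq.
Qed.

Lemma measurable_msupport : measurable (msupport mu).
Proof.
rewrite -[msupport mu]setCK msupportC; apply: measurableC.
by apply: bigcupT_measurable => n; exact: measurable_null_box.
Qed.

Lemma measure_msupportC : mu (~` msupport mu) = 0%E.
Proof.
rewrite msupportC; apply/eqP; rewrite eq_le measure_ge0 andbT.
have mU : measurable (\bigcup_n null_box n) by apply: bigcupT_measurable => n;
  exact: measurable_null_box.
apply: (le_trans (@measure_sigma_subadditive _ _ _ mu _ null_box measurable_null_box mU (fun x H => H))).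
rewrite eseries0// => n _ _; rewrite /null_box.
by case: unpickle => // c; case: ifPn => [/eqP//|_]; exact: measure0.
Qed.

End support.

Section ball_mass.
Context (R : realType) (d : nat) (hd : (0 < d)%N).
Local Notation point := (euclid R d).

(** The ball contains the cube of half-side [r / d]. *)
Lemma lebesgue_eball_ge (x : point) (r : R) : 0 < r ->
  (((2 / d%:R) ^+ d * r ^+ d)%:E <= lebesgue_tuple R d (eball x r))%E.
Proof.
move=> r0; have d0 : 0 < d%:R :> R by rewrite ltr0n.
have rd0 : 0 < r / d%:R by rewrite divr_gt0.
pose A (i : 'I_d) : set (measurableTypeR R) :=
  [set` `[(tnth x i : R) - r / d%:R, (tnth x i : R) + r / d%:R]].
have mA i : measurable (A i) by exact: measurable_itv.
have mB : measurable [set y : point | forall i, A i (tnth y i)].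
  rewrite (_ : [set y | _] = \bigcap_(i in [set: 'I_d]) ((@tnth d _)^~ i @^-1` A i)).
    apply: fin_bigcap_measurable => [|i _]; first exact: finite_finset.
    by rewrite -[X in measurable X]setTI; exact: measurable_tnth.
  by apply/seteqP; split => [t H i _|t H i]; [exact: H|exact: (H i Logic.I)].
have -> : ((2 / d%:R) ^+ d * r ^+ d)%:E = lebesgue_tuple R d [set y : point | forall i, A i (tnth y i)].
  rewrite /lebesgue_tuple tuple_power_box// (eq_bigr (fun=> (2 * r / d%:R)%:E)).
    rewrite prodEFin prodr_const card_ord -exprMn; congr (_ ^+ _)%:E; ring.
  move=> i _; transitivity (lebesgue_measure
    [set` `[(tnth x i : R) - r / d%:R, (tnth x i : R) + r / d%:R]]); first by [].
  rewrite lebesgue_measure_itv/= lte_fin ifT; last by lra.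
  by rewrite -EFinB; congr EFin; field; rewrite gt_eqF.
apply: le_measure; rewrite ?inE//; first exact: measurable_eball.
move=> y Hy /=; apply: (le_trans (@edist_le_box _ _ x y (r / d%:R) (ltW rd0) _)).
  move=> i; have := Hy i; rewrite /A/= in_itv/= => /andP[y1 y2].
  by rewrite ler_norml; apply/andP; split; lra.
by rewrite mulrC divfK// gt_eqF.
Qed.

(** One factor [cl] bounds the density from below, the other the share of the ball lying in the
    support. *)
Lemma ball_mass_ge (P : joint_law R d) (cl : R) (p : point -> R) (x : point) (r : R) :
  0 < cl ->
  is_density (marginal P) p ->
  (forall y, msupport (marginal P) y -> cl < p y) ->
  (cl%:E * lebesgue_tuple R d (eball x r) <=
     lebesgue_tuple R d (msupport (marginal P) `&` eball x r))%E ->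
  0 < r ->
  ((cl ^+ 2 * (2 / d%:R) ^+ d * r ^+ d)%:E <= marginal P (eball x r))%E.
Proof.
move=> cl0 [mp p0 pE] pcl Hcl r0.
set Om := msupport _ in pcl Hcl.
have mOm : measurable Om by exact: measurable_msupport.
have mB := measurable_eball x r.
have mI := measurableI _ _ mOm mB.
apply: (@le_trans _ _ (marginal P (Om `&` eball x r))); last first.
  by apply: le_measure; rewrite ?inE//; exact: subIsetr.
rewrite pE//.
apply: (@le_trans _ _ (\int[lebesgue_tuple R d]_(y in Om `&` eball x r) cl%:E)%E).
  rewrite integral_cst//.
  apply: le_trans (lee_wpmul2l _ Hcl); last by rewrite lee_fin ltW.
  rewrite muleA -EFinM -expr2 -mulrA EFinM; apply: lee_wpmul2l.
    by rewrite lee_fin sqr_ge0.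
  exact: lebesgue_eball_ge.
apply: ge0_le_integral => //.
- by move=> y _; rewrite lee_fin ltW.
- by apply: measurable_funTS; exact/measurable_EFinP.
- by move=> y [Omy _]; rewrite lee_fin ltW// pcl.
Qed.

End ball_mass.

(** * Pointwise error of the classifiers *)

Section margin.
Context (R : realType) (d : nat).
Local Notation point := (euclid R d).
Implicit Types (P Q : joint_law R d) (x y : point) (Om : set point).

Lemma edistxx x : edist x x = 0.
Proof.
rewrite /edist big1 ?sqrtr0// => i _; by rewrite subrr expr0n.
Qed.

Lemma label_prob_dist P b x y : `|label_prob P b x - label_prob P b y| = `|eta P x - eta P y|.
Proof.
case: b => //=; rewrite distrC; congr `|_|; ring.
Qed.

Lemma label_prob_bayes Q x : label_prob Q (bayes Q x) x - 2^-1 = `|eta Q x - 2^-1|.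
Proof.
rewrite /bayes /label_prob; case: leP => h; first by rewrite ger0_norm// subr_ge0.
by rewrite ltr0_norm ?subr_lt0//; lra.
Qed.

(** The sign condition forces the signal of [P] to the side [b] on which [Q] stands, which removes
    the absolute values. *)
Lemma label_prob_signal (C g : R) P Q Om b y : relative_signal C g P Q Om -> Om y ->
  0 < label_prob Q b y - 2^-1 ->
  C * (label_prob Q b y - 2^-1) `^ g <= label_prob P b y - 2^-1.
Proof.
move=> RS Omy; have [sg lb] := RS y Omy.
case: b => /= u0.
  rewrite -[X in X `^ _]gtr0_norm// (le_trans lb)// ger0_norm//.
  by rewrite -(pmulr_lge0 _ u0).
have u0' : eta Q y - 2^-1 < 0 by lra.
rewrite (_ : _ - eta Q y - _ = `|eta Q y - 2^-1|); last by rewrite ltr0_norm//; lra.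
apply: (le_trans lb); rewrite ler0_norm; first by lra.
by rewrite -(nmulr_lge0 _ u0').
Qed.

(** The two cases differ in the order of the steps. For [betaP], the signal is carried from [Q] to
    [P] at [x] and then moved to [y] by the smoothness of [eta P]; for [gamma * betaQ], it is first
    moved to [y] by the smoothness of [eta Q] and carried to [P] there. *)
Lemma margin_persists (th : params R) (be : R) : valid_params th ->
  be = betaP th \/ be = gamma th * betaQ th ->
  exists A cm : R, [/\ 0 < A, 0 < cm &
    forall P Q Om, holder (C_beta th) (betaP th) Om (eta P) ->
      holder (C_beta th) (betaQ th) Om (eta Q) ->
      relative_signal (C_gamma th) (gamma th) P Q Om ->
      forall x r, Om x -> 0 <= r -> 0 < `|eta Q x - 2^-1| ->
        A * r `^ be <= `|eta Q x - 2^-1| `^ gamma th ->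
        forall y, Om y -> edist y x <= r ->
          2^-1 + cm * `|eta Q x - 2^-1| `^ gamma th <= label_prob P (bayes Q x) y].
Proof.
move=> [_ /andP[bP0 _] /andP[bQ0 _] _ [g0 _ _ [Cb0 _ Cg0]]] [->|->].
  (* This [A] makes the Hölder loss at most half of [C_gamma * zeta^gamma]. *)
  exists (2 * C_beta th / C_gamma th), (C_gamma th / 2); split.
  - by rewrite divr_gt0// mulr_gt0.
  - by rewrite divr_gt0.
  move=> P Q Om hP hQ RS x r Omx r0 z0 Ar y Omy yx.
  have := label_prob_signal RS Omx (b := bayes Q x); rewrite label_prob_bayes => /(_ z0) Px.
  have := hP y x Omy Omx; rewrite -(label_prob_dist P (bayes Q x)) => Pyx.
  have rb : edist y x `^ betaP th <= r `^ betaP th.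
    by apply: ge0_ler_powR; rewrite ?nnegrE ?sqrtr_ge0.
  have Cr : C_beta th * r `^ betaP th <= C_gamma th / 2 * `|eta Q x - 2^-1| `^ gamma th.
    rewrite (_ : C_beta th * _ = C_gamma th / 2 * (2 * C_beta th / C_gamma th * r `^ betaP th)).
      by apply: ler_wpM2l => //; rewrite divr_ge0// ltW.
    by field; rewrite gt_eqF.
  have := ler_wpM2l (ltW Cb0) rb.
  move: Pyx; rewrite ler_norml => /andP[Pyx _]; lra.
(* This [A] makes the variation of [eta Q] at most [zeta / 2], so half of the signal of [Q] survives
   at [y], whence the power of 1/2 in [cm]. *)
exists ((2 * C_beta th) `^ gamma th), (C_gamma th * 2^-1 `^ gamma th); split.
- by rewrite powR_gt0// mulr_gt0.
- by rewrite mulr_gt0// powR_gt0.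
move=> P Q Om hP hQ RS x r Omx r0 z0 Ar y Omy yx.
have := hQ y x Omy Omx; rewrite -(label_prob_dist Q (bayes Q x)) => Qyx.
have rb : edist y x `^ betaQ th <= r `^ betaQ th.
  by apply: ge0_ler_powR; rewrite ?nnegrE ?sqrtr_ge0.
have Cr : 2 * C_beta th * r `^ betaQ th <= `|eta Q x - 2^-1|.
  have rQ0 : 0 <= r `^ betaQ th by exact: powR_ge0.
  have C0 : 0 <= 2 * C_beta th by rewrite mulr_ge0// ltW.
  rewrite leNgt; apply/negP => /(gt0_ltr_powR g0);
    rewrite !nnegrE normr_ge0 mulr_ge0// => /(_ isT isT).
  rewrite powRM// -powRrM [betaQ th * _]mulrC; apply/negP; by rewrite -leNgt.
have := label_prob_bayes Q x.
have := ler_wpM2l (ltW Cb0) rb.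
move: Qyx; rewrite ler_norml => /andP[Qyx _] h1 h2.
have Qy : `|eta Q x - 2^-1| / 2 <= label_prob Q (bayes Q x) y - 2^-1 by lra.
have Qy0 : 0 < label_prob Q (bayes Q x) y - 2^-1 by apply: lt_le_trans Qy; rewrite divr_gt0.
have := label_prob_signal RS Omy Qy0.
suff : C_gamma th * 2^-1 `^ gamma th * `|eta Q x - 2^-1| `^ gamma th <=
   C_gamma th * (label_prob Q (bayes Q x) y - 2^-1) `^ gamma th by lra.
rewrite -mulrA; apply: ler_wpM2l; first exact: ltW.
rewrite -powRM//.
apply: ge0_ler_powR; rewrite ?nnegrE; [exact: ltW| | |by rewrite mulrC].
  by rewrite mulr_ge0.
exact: ltW.
Qed.

End margin.

Section pointwise_error.
Context (R : realType) (d n : nat) (P : joint_law R d).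
Local Notation point := (euclid R d).
Variables (Om : set point) (x : point) (b : bool) (r m p : R) (k : nat).
Hypotheses (mOm : measurable Om) (Om1 : marginal P (~` Om) = 0%E) (Omx : Om x)
  (m0 : 0 <= m) (kn : (1 <= k <= n)%N) (r0 : 0 <= r)
  (Bp : (p%:E <= marginal P (eball x r))%E) (kp : 4 * k%:R <= n%:R * p)
  (Pm : forall y, Om y -> edist y x <= r -> 2^-1 + m <= label_prob P b y).
Local Notation Pn := (iid (law P) n).

Let few_neighbors : (Pn [set s | ~ (k <= ball_count r s x)%N] <= (expR (- k%:R))%:E)%E.
Proof.
have [q Bq] : exists q, marginal P (eball x r) = q%:E.
  by exists (fine (marginal P (eball x r))); rewrite fineK// fin_num_measure//;
    exact: measurable_eball.
apply: (ball_count_tail Bq); apply: (le_trans kp); apply: ler_wpM2l => //.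
by rewrite -lee_fin -Bq.
Qed.

Let m_half : m <= 2^-1.
Proof.
have := Pm Omx; rewrite edistxx => /(_ r0).
have := label_prob_le1 P b x; lra.
Qed.

(** An error needs either too few observations in the ball or a vote that is not positive. *)
Lemma f_NN_error : (Pn [set s | f_NN k s x != b]
  <= (expR (- k%:R))%:E + (expR (- (k%:R * m ^+ 2 / 2)))%:E)%E.
Proof.
pose E1 : set (n.-tuple (point * bool)) := [set s | ~ (k <= ball_count r s x)%N].
pose E2 : set (n.-tuple (point * bool)) := [set s | (k <= ball_count r s x)%N /\ vote b k s x <= 0].
have mE1 : measurable E1 := measurableC (measurable_ball_count_ge (n := n) k r x).
have mE2 : measurable E2.
  by apply: measurableI; [exact: measurable_ball_count_ge|exact: measurable_vote_le].
have mf : measurable [set s : n.-tuple (point * bool) | f_NN k s x != b].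
  have mF : measurable [set s : n.-tuple (point * bool) | f_NN k s x].
    exact: (measurable_pair_cst x (@measurable_f_NN R d n k)).
  case: b; last by congr measurable: mF; apply/seteqP; split => s /=; case: f_NN.
  by have := measurableC mF; congr measurable; apply/seteqP; split => s /=; case: f_NN.
apply: (@le_trans _ _ (Pn (E1 `|` E2))).
  apply: le_measure; rewrite ?inE//; first exact: measurableU.
  move=> s /= /negP fb; have [ks|ks] := boolP (k <= ball_count r s x)%N; last by left; exact/negP.
  right; split => //; rewrite leNgt; apply/negP => v0; apply: fb.
  by rewrite (f_NN_vote kn v0).
apply: (le_trans (measureU2 _ mE1 mE2)); apply: leeD; first exact: few_neighbors.
(* [t = m / 2] minimizes [2 t^2 - 2 m t], with value [- m^2 / 2]. *)
have t01 : 0 <= m / 2 <= 1 by have := m_half; rewrite divr_ge0//=; lra.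
have kkn : (k <= k <= n)%N by rewrite leqnn; case/andP: kn.
apply: (le_trans (vote_tail 0 mOm Om1 kkn t01 Pm)).
by rewrite lee_fin ler_expR le_eqVlt; apply/orP; left; apply/eqP; field.
Qed.

Lemma vote_ge b' j (s : n.-tuple (point * bool)) : (j <= n)%N -> - j%:R <= vote b' j s x.
Proof.
move=> jn; rewrite -{1}(size_neighbors s x jn) -sum1_size natr_sum -sumrN.
by apply: ler_sum => i _; case: ifP => _; lra.
Qed.

Let tau := threshold R d n.

(** By [f_pa_vote], an error needs too few observations in the ball or one of [k + 1] vote events.
    Each of these has probability at most [exp (- tau^2 / 2)], the tilt for a vote of [j] neighbors
    being [tau / (2 sqrt j)]. *)
Lemma f_pa_error : 0 < tau -> 2 * tau <= m * Num.sqrt k%:R ->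
  (Pn [set s | f_pa s x != b]
     <= (expR (- k%:R))%:E + (k.+1%:R * expR (- (tau ^+ 2 / 2)))%:E)%E.
Proof.
move=> tau0 mtau; have /andP[k1 k_n] := kn.
have sq0 j : (0 < j)%N -> 0 < Num.sqrt j%:R :> R by move=> j0; rewrite sqrtr_gt0 ltr0n.
have sqq j : Num.sqrt j%:R * Num.sqrt j%:R = j%:R :> R by rewrite -expr2 sqr_sqrtr.
pose E1 : set (n.-tuple (point * bool)) := [set s | ~ (k <= ball_count r s x)%N].
(* E2 j, for j < k: the j.+1 nearest neighbors trigger the stopping rule with the
   wrong sign; E2 k: the k nearest ones do not trigger it. *)
pose a j : R := if (j < k)%N then - (2 * tau * Num.sqrt j.+1%:R) else 2 * tau * Num.sqrt k%:R.
pose K j := if (j < k)%N then j.+1 else k.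
pose E2 j : set (n.-tuple (point * bool)) :=
  [set s | (k <= ball_count r s x)%N /\ vote b (K j) s x <= a j].
have mE1 : measurable E1 := measurableC (measurable_ball_count_ge (n := n) k r x).
have mE2 j : measurable (E2 j).
  by apply: measurableI; [exact: measurable_ball_count_ge|exact: measurable_vote_le].
have mf : measurable [set s : n.-tuple (point * bool) | f_pa s x != b].
  have mF : measurable [set s : n.-tuple (point * bool) | f_pa s x].
    exact: (measurable_pair_cst x (@measurable_f_pa R d n)).
  case: b; last by congr measurable: mF; apply/seteqP; split => s /=; case: f_pa.
  by have := measurableC mF; congr measurable; apply/seteqP; split => s /=; case: f_pa.
have mU : measurable (\big[setU/set0]_(j < k.+1) E2 j).
  by apply: bigsetU_measurable.
apply: (@le_trans _ _ (Pn (E1 `|` \big[setU/set0]_(j < k.+1) E2 j))).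
  apply: le_measure; rewrite ?inE//; first exact: measurableU.
  move=> s /= /negP fb; have [ks|ks] := boolP (k <= ball_count r s x)%N; last by left; exact/negP.
  right; apply: contrapT => nE; apply: fb; apply/eqP.
  have nE' j : (j < k.+1)%N -> a j < vote b (K j) s x.
    move=> jk; rewrite ltNge; apply/negP => va; apply: nE.
    by rewrite -bigcup_mkord; exists j.
  apply: (@f_pa_vote _ _ _ b k) => //; first exact: ltW.
    move=> j /andP[j1 jk]; have := nE' j.-1; rewrite /a /K prednK// jk; apply.
    exact: leq_trans jk _.
  by have := nE' k; rewrite /a /K ltnn; apply.
apply: (le_trans (measureU2 _ mE1 mU)); apply: leeD; first exact: few_neighbors.
apply: (le_trans (Boole_inequality _ _)) => //.
rewrite mulr_natl -[k.+1 in leRHS]card_ord -sumr_const -sumEFin.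
apply: lee_sum => j _.
have [jk|kj] := ltnP j k.
  have j1 := sq0 j.+1 isT.
  (* When [tau] exceeds [2 sqrt (j + 1)], the level is beyond what [j + 1] votes can reach and the
     event is empty; otherwise the tilt is at most 1. *)
  have [tj|tj] := leP tau (2 * Num.sqrt j.+1%:R); last first.
    rewrite (_ : E2 j = set0) ?measure0 ?lee_fin ?expR_ge0//.
    apply/seteqP; split => // s [_]; rewrite /a /K jk.
    have := vote_ge b s (leq_trans jk k_n); have := sqq j.+1; nra.
  have t01 : 0 <= tau / (2 * Num.sqrt j.+1%:R) <= 1.
    by apply/andP; split; [apply: divr_ge0; lra|rewrite ler_pdivrMr ?mul1r; lra].
  (* Bias 0 is enough against a stop with the wrong sign: the exponent is [- tau^2 + tau^2 / 2]. *)
  have Pm0 y : Om y -> edist y x <= r -> 2^-1 + 0 <= label_prob P b y.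
    by move=> Omy /(Pm Omy); apply: le_trans; rewrite lerD2l.
  have jkn : (j.+1 <= k <= n)%N by rewrite jk.
  rewrite /E2 /K /a jk; apply: (le_trans (vote_tail _ mOm Om1 jkn t01 Pm0)).
  rewrite lee_fin ler_expR -[X in X * (2 * _ - _)]sqq le_eqVlt; apply/orP; left; apply/eqP.
  by field; rewrite gt_eqF.
have j1 := sq0 k k1.
have t01 : 0 <= tau / (2 * Num.sqrt k%:R) <= 1.
  by have mh := m_half; apply/andP; split; [apply: divr_ge0; lra|rewrite ler_pdivrMr ?mul1r; nra].
have kkn : (k <= k <= n)%N by rewrite leqnn.
rewrite /E2 /K /a ltnNge kj/=; apply: (le_trans (vote_tail _ mOm Om1 kkn t01 Pm)).
rewrite lee_fin ler_expR -[X in X * (2 * _ - _)]sqq.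
(* By the signal hypothesis the subtracted term is at least [2 tau^2], which leaves at most
   [- tau^2 / 2]. *)
rewrite (_ : _ + _ = tau ^+ 2 + tau ^+ 2 / 2 - tau * (m * Num.sqrt k%:R)); last first.
  by field; rewrite gt_eqF.
nra.
Qed.

End pointwise_error.

(** * Excess risk *)

Section excess_risk.
Context (R : realType) (d : nat).
Local Notation point := (euclid R d).
Implicit Types (P Q : joint_law R d).

Lemma measurable_bool_fun e (T : measurableType e) (g : T -> bool) :
  measurable [set z | g z] -> measurable_fun setT g.
Proof. by move=> mg; apply: (measurable_fun_bool true); rewrite setTI. Qed.

Lemma measurable_label_prob_comp Q e (T : measurableType e) (g : T -> bool) (h : T -> point) :
  measurable [set z | g z] -> measurable_fun setT h ->
  measurable_fun setT (fun z => (label_prob Q (~~ g z) (h z))%:E).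
Proof.
move=> mg mh; apply/measurable_EFinP.
have mif : measurable_fun setT
    (fun z => if g z then label_prob Q false (h z) else label_prob Q true (h z)).
  by apply: measurable_fun_ifT; [exact: measurable_bool_fun|
    exact: (measurableT_comp (measurable_label_prob Q _))|
    exact: (measurableT_comp (measurable_label_prob Q _))].
by move: mif; congr measurable_fun; apply/funext => z; case: (g z).
Qed.

Lemma riskE Q (f : point -> bool) : measurable [set x | f x] ->
  risk Q f = (\int[marginal Q]_x (label_prob Q (~~ f x) x)%:E)%E.
Proof.
move=> mf; have mfC := measurableC mf.
have ml b : measurable_fun setT (fun x => (label_prob Q b x)%:E).
  by apply/measurable_EFinP; exact: measurable_label_prob.
have l0 b x : (0 <= (label_prob Q b x)%:E)%E by rewrite lee_fin label_prob_ge0.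
rewrite /risk (_ : [set z | _] = ([set x | f x] `*` [set false]) `|` (~` [set x | f x] `*` [set true])); last first.
  apply/seteqP; split => [[x [|]]|[x y]] /=.
  - by case fx : (f x) => // _; right; split=> //=; rewrite fx.
  - by case fx : (f x) => // _; left.
  - by move=> [[-> ->]//|[/negP/negbTE -> ->]].
rewrite measureU; [|exact: measurableX|exact: measurableX|]; last first.
  by apply/seteqP; split => // -[x y] [[/= ? ->] [_]].
rewrite [X in (X + _)%E](law_label Q false mf) [X in (_ + X)%E](law_label Q true mfC).
rewrite -[in RHS](setUv [set x | f x]) ge0_integral_setU//; last 2 first.
- by rewrite setUv; exact: measurable_label_prob_comp.
- by apply/disj_setPS => x [].
congr (_ + _)%E; apply: eq_integral => x /set_mem /=; first by move=> ->.
by move=> /negP/negbTE ->.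
Qed.

Section data_dependent.
Variables (n : nat) (f : n.-tuple (point * bool) -> point -> bool).
Hypothesis mf : measurable [set z : n.-tuple (point * bool) * point | f z.1 z.2].

Lemma measurable_bayes Q : measurable [set x | bayes Q x].
Proof.
have [me _ _] := eta_regression Q.
have mb : measurable_fun setT (fun x => 2^-1 <= eta Q x) by exact: measurable_fun_ler.
by have := mb measurableT [set true] Logic.I; rewrite setTI.
Qed.

Lemma measurable_misclassified Q : measurable [set z | f z.1 z.2 != bayes Q z.2].
Proof.
have m1 := measurable_bool_fun mf.
have m2 : measurable_fun setT (fun z : n.-tuple (point * bool) * point => bayes Q z.2).
  exact: (measurableT_comp (measurable_bool_fun (measurable_bayes Q)) measurable_snd).
have m3 : measurable_fun setT (fun z : n.-tuple (point * bool) * point =>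
    if bayes Q z.2 then ~~ f z.1 z.2 else f z.1 z.2).
  by apply: measurable_fun_ifT => //; exact: measurable_neg.
have := m3 measurableT [set true] Logic.I; rewrite setTI; congr measurable.
by apply/seteqP; split => z /=; case: (bayes Q z.2); case: (f z.1 z.2).
Qed.

(** Where [f] disagrees with the Bayes classifier, the conditional errors differ by exactly
    [2 |eta Q - 1/2|]; Tonelli then brings the expectation over the sample inside. *)
Lemma excess_risk_le P Q : (excess_risk f P Q <=
  \int[marginal Q]_x ((2 * `|eta Q x - 2^-1|)%:E *
     iid (law P) n [set s | f s x != bayes Q x]))%E.
Proof.
have [me _ _] := eta_regression Q.
have mmis := measurable_misclassified Q.
have mfs s : measurable [set x | f s x].
  have mp : measurable_fun setT (fun x : point => (s, x)) by exact: measurable_fun_pair.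
  by have := mp measurableT _ mf; rewrite setTI.
pose zeta x := 2 * `|eta Q x - 2^-1|.
have z0 x : 0 <= zeta x by rewrite mulr_ge0.
have mz : measurable_fun setT zeta.
  apply: measurable_funM => //; apply: measurableT_comp => //.
  exact: measurable_funB.
pose H (z : n.-tuple (point * bool) * point) : \bar R :=
  (zeta z.2 * \1_[set z | f z.1 z.2 != bayes Q z.2] z)%:E.
have mH : measurable_fun setT H.
  apply/measurable_EFinP; apply: measurable_funM; first exact: (measurableT_comp mz).
  exact: measurable_indic.
have H0 z : (0 <= H z)%E by rewrite lee_fin mulr_ge0.
pose L (z : n.-tuple (point * bool) * point) : \bar R := (label_prob Q (~~ f z.1 z.2) z.2)%:E.
have mL : measurable_fun setT L.
  by apply: measurable_label_prob_comp.
have L0 z : (0 <= L z)%E by rewrite lee_fin label_prob_ge0.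
have mpair s : measurable_fun setT (fun x : point => (s : n.-tuple (point * bool), x)).
  exact: measurable_fun_pair.
have mHs s : measurable_fun setT (fun x => H (s, x)) by exact: (measurableT_comp mH).
have mLs s : measurable_fun setT (fun x => L (s, x)) by exact: (measurableT_comp mL).
have mbay := measurable_bayes Q.
have mLb : measurable_fun setT (fun x => (label_prob Q (~~ bayes Q x) x)%:E).
  exact: measurable_label_prob_comp.
pose rb := risk Q (bayes Q).
have rb0 : (0 <= rb)%E by exact: measure_ge0.
(* Finiteness allows the Bayes risk to be moved across the inequality in the extended reals. *)
have rbfin : rb \is a fin_num.
  rewrite ge0_fin_numE// /rb riskE//.
  apply: (@le_lt_trans _ _ (\int[marginal Q]_x (cst 1%E x))%E).
    apply: ge0_le_integral => //.
    - by move=> x _; rewrite lee_fin label_prob_ge0.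
    - by move=> x _; rewrite lee_fin label_prob_le1.
  by rewrite integral_cst// mul1e [ltLHS](_ : _ = 1%E) ?ltry//; exact: probability_setT.
have riskf s : (risk Q (f s) = \int[marginal Q]_x L (s, x))%E by exact: riskE.
have mrisk : measurable_fun setT (fun s => risk Q (f s)).
  rewrite (_ : (fun s => _) = fubini_F (marginal Q) L); last by apply/funext => s; exact: riskf.
  exact: measurable_fun_fubini_tonelli_F.
rewrite /excess_risk leeBlDr// -/rb.
apply: (@le_trans _ _ (\int[iid (law P) n]_s (rb + \int[marginal Q]_x H (s, x)))%E).
  apply: ge0_le_integral => //.
  - apply: emeasurable_funD => //.
    exact: (measurable_fun_fubini_tonelli_F (m2 := marginal Q) H).
  - move=> s _; rewrite riskf /rb riskE// -ge0_integralD//; last by move=> x _;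
    rewrite lee_fin label_prob_ge0.
    apply: ge0_le_integral => //.
    + exact: emeasurable_funD.
    move=> x _; rewrite /L /H/= -EFinD lee_fin indicE.
    have [fb|/negPn/eqP ->] := boolP (f s x != bayes Q x).
      rewrite mem_set//= mulr1 /zeta -label_prob_bayes (label_probN Q (bayes Q x)).
      have -> : ~~ f s x = bayes Q x by move: fb; case: (f s x); case: (bayes Q x).
      lra.
    by rewrite lerDl mulr_ge0.
rewrite ge0_integralD//; last 2 first.
- by move=> s _; exact: integral_ge0.
- exact: (measurable_fun_fubini_tonelli_F (m2 := marginal Q) H).
rewrite integral_cst// [X in (_ * X)%E](_ : _ = 1%E); last exact: probability_setT.
rewrite mule1 addeC leeD2r//.
rewrite (fubini_tonelli (m1 := iid (law P) n) (m2 := marginal Q))//.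
rewrite le_eqVlt; apply/orP; left; apply/eqP; apply: eq_integral => x _.
have mx := measurable_pair_cst x mmis.
rewrite /H/=; under eq_integral do rewrite EFinM.
rewrite ge0_integralZl//; last 2 first.
- apply/measurable_EFinP.
  have m1 : measurable_fun setT (fun s : n.-tuple (point * bool) => (s, x)).
    exact: measurable_fun_pair.
  exact: (measurableT_comp (measurable_indic mmis) m1).
- by rewrite lee_fin.
congr (_ * _)%E.
rewrite (eq_integral (fun s => (\1_[set s | f s x != bayes Q x] s)%:E)).
  by rewrite integral_indic// setIT.
by move=> s _; rewrite !indicE; congr (nat_of_bool _)%:R%:E; apply/idP/idP => /set_mem ?;
  exact/mem_set.
Qed.

End data_dependent.

End excess_risk.

(** * The noise condition and the dyadic decomposition *)

Section noise.
Context (R : realType) (d : nat).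
Local Notation point := (euclid R d).
Implicit Types (P Q : joint_law R d).

Lemma dyadic_level (z de : R) (J : nat) : z < 2 ^+ J * de -> ~ z < de ->
  exists2 i, (i < J)%N & 2 ^+ i * de <= z < 2 ^+ i.+1 * de.
Proof.
elim: J => [|J IH]; first by rewrite expr0 mul1r.
move=> zJ zde; have [zJ'|Jz] := ltP z (2 ^+ J * de).
  by have [i iJ iz] := IH zJ' zde; exists i => //; exact: ltnW.
by exists J; rewrite ?Jz.
Qed.

(** The dyadic levels may pass 1/2, where the range of the noise condition ends; beyond it a
    probability is at most [1 <= (2 t)^a], whence the second constant. *)
Lemma tsybakov_all (C a : R) Q : 0 <= a -> tsybakov_noise C a Q ->
  forall t, 0 < t ->
    (marginal Q [set x | (`|eta Q x - 2^-1| < t)%R] <= (Num.max C (2 `^ a) * t `^ a)%R%:E)%E.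
Proof.
move=> a0 TN t t0; have [t2|t2] := leP t 2^-1.
  apply: (le_trans (TN t _)); first by rewrite t0.
  by rewrite lee_fin ler_wpM2r ?powR_ge0// le_max lexx.
have [me _ _] := eta_regression Q.
have mz : measurable_fun setT (fun x => `|eta Q x - 2^-1| < t).
  apply: measurable_fun_ltr => //; apply: measurableT_comp => //; exact: measurable_funB.
have mS : measurable [set x | `|eta Q x - 2^-1| < t].
  by have := mz measurableT [set true] Logic.I; rewrite setTI.
apply: (le_trans (probability_le1 _ mS)); rewrite lee_fin.
apply: (@le_trans _ _ (2 `^ a * t `^ a)).
  rewrite -powRM//; last exact: ltW.
  rewrite -[leLHS](powRr0 (2 * t)); apply: ler_powR => //; lra.
by rewrite ler_wpM2r ?powR_ge0// le_max lexx orbT.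
Qed.

Variables (n : nat) (f : n.-tuple (point * bool) -> point -> bool).
Hypothesis mf : measurable [set z : n.-tuple (point * bool) * point | f z.1 z.2].

(** The decay exponent is [al + 2] because one power is spent on the factor [zeta] of the excess
    risk and [al] powers on the mass of the shells; the last one makes the series geometric with
    ratio 1/2. [eps] keeps the coefficient 1 since [2 zeta <= 1]. *)
Lemma excess_risk_bound P Q Om (al Ca B de eps : R) :
  measurable Om -> marginal Q (~` Om) = 0%E ->
  0 <= al -> 0 <= B -> 0 < de -> 0 <= eps -> tsybakov_noise Ca al Q ->
  (forall x, Om x -> 0 < `|eta Q x - 2^-1| ->
     (iid (law P) n [set s | f s x != bayes Q x] <=
        (eps + B * (de / `|eta Q x - 2^-1|) `^ (al + 2))%:E)%E) ->
  (excess_risk f P Q <=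
    (eps + 2 * (2 + 2 * B * 2 `^ (al + 1)) * Num.max Ca (2 `^ al) * de `^ (1 + al))%:E)%E.
Proof.
move=> mOm Om1 al0 B0 de0 eps0 TN err.
apply: (le_trans (excess_risk_le mf P Q)).
have [me e01 _] := eta_regression Q.
pose z x := `|eta Q x - 2^-1|.
have z0 x : 0 <= z x by exact: normr_ge0.
have zh x : z x <= 2^-1 by have /andP[? ?] := e01 x; rewrite ler_norml; apply/andP; split; lra.
have mz : measurable_fun setT z by apply: measurableT_comp => //; exact: measurable_funB.
have mS t : measurable [set x | z x < t].
  have mzt : measurable_fun setT (fun x => z x < t) by exact: measurable_fun_ltr.
  by have := mzt measurableT [set true] Logic.I; rewrite setTI.
have [J HJ] : exists J : nat, 2^-1 < 2 ^+ J * de.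
  have [N HN] : exists N : nat, (2 * de)^-1 < N%:R.
    by exists (Num.bound (2 * de)^-1); apply: archi_boundP; rewrite invr_ge0 mulr_ge0// ltW.
  exists N; have N2 : N%:R <= 2 ^+ N :> R by rewrite -natrX ler_nat ltnW// ltn_expl.
  have := lt_le_trans HN N2; rewrite -[_^-1]mul1r ltr_pdivrMr ?mulr_gt0//; lra.
(* The summand 2 serves the lowest shell, [zeta < de], where the error is bounded by 1; the other
   one serves the shells above. *)
pose K := 2 + 2 * B * 2 `^ (al + 1).
have K0 : 2 <= K by rewrite lerDl !mulr_ge0// powR_ge0.
(* c j bounds 2 zeta times the error on the shell 2^(j-1) de <= zeta < 2^j de. *)
pose c (j : nat) := K * de * (2 ^+ j)^-1 `^ (al + 1).
have c0 j : 0 <= c j by rewrite /c !mulr_ge0 ?powR_ge0//; lra.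
pose g x := eps + \sum_(j < J.+1) c j * \1_[set x | z x < 2 ^+ j * de] x.
have g0 x : 0 <= g x by rewrite addr_ge0// sumr_ge0// => j _; rewrite mulr_ge0.
have mg : measurable_fun setT g.
  apply: measurable_funD => //; apply: measurable_sum => j.
  by apply: measurable_funM => //; exact: measurable_indic.
have pt x : Om x -> ((2 * z x)%:E * iid (law P) n [set s | f s x != bayes Q x] <= (g x)%:E)%E.
  move=> Omx.
  have sub j : (j < J.+1)%N -> z x < 2 ^+ j * de -> eps + c j <= g x.
    move=> jJ zj; rewrite lerD2l (bigD1 (Ordinal jJ))//= indicE mem_set//= mulr1 lerDl.
    by apply: sumr_ge0 => i _; rewrite mulr_ge0.
  have mm := measurable_pair_cst x (measurable_misclassified mf Q).
  have p1 := probability_le1 (iid (law P) n) mm.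
  have [zde|zde] := pselect (z x < de).
    apply: (@le_trans _ _ (2 * z x)%:E).
      by rewrite -[leRHS]mule1; apply: lee_wpmul2l; rewrite // lee_fin mulr_ge0.
    rewrite lee_fin; apply: le_trans (sub 0%N isT _); last by rewrite expr0 mul1r.
    by rewrite /c expr0 invr1 powR1; nra.
  have [i iJ /andP[zi zi1]] := dyadic_level (le_lt_trans (zh x) HJ) zde.
  have zp : 0 < z x by apply: lt_le_trans zi; rewrite mulr_gt0// exprn_gt0.
  apply: le_trans (lee_wpmul2l _ (err x Omx zp)) _; first by rewrite lee_fin mulr_ge0.
  rewrite -EFinM lee_fin; apply: le_trans (sub i.+1 iJ zi1).
  rewrite mulrDr; apply: lerD; first by have := zh x; nra.
  have dz0 : 0 < de / z x by rewrite divr_gt0.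
  have -> : 2 * z x * (B * (de / z x) `^ (al + 2)) = 2 * B * de * (de / z x) `^ (al + 1).
    rewrite (_ : al + 2 = (al + 1) + 1); last by ring.
    rewrite powRD; last by rewrite (gt_eqF dz0) implybT.
    by rewrite powRr1 ?(ltW dz0)//; field; rewrite gt_eqF.
  (* On this shell [de / zeta <= 2^(-i)]; writing it with [i + 1] costs a factor 2, hence the power
     of 2 in [K]. *)
  have dz : de / z x <= 2 * (2 ^+ i.+1)^-1.
    rewrite ler_pdivrMr// exprS invfM mulrA divff// mul1r ler_pdivlMl ?exprn_gt0//.
  have := @ge0_ler_powR R (al + 1) _ (de / z x) (2 * (2 ^+ i.+1)^-1).
  rewrite !nnegrE (ltW dz0) mulr_ge0 ?invr_ge0 ?exprn_ge0// => /(_ _ isT isT dz) H.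
  have {}H := H (addr_ge0 al0 ler01).
  rewrite [leRHS]powRM ?invr_ge0 ?exprn_ge0// in H.
  have pw : 0 <= (2 ^+ i.+1)^-1 `^ (al + 1) :> R by exact: powR_ge0.
  rewrite /c /K; have Bde : 0 <= 2 * B * de by rewrite !mulr_ge0// ltW.
  apply: (le_trans (ler_wpM2l Bde H)); rewrite -subr_ge0.
  rewrite (_ : _ - _ = 2 * (de * (2 ^+ i.+1)^-1 `^ (al + 1))); last by ring.
  by rewrite !mulr_ge0// ltW.
apply: (@le_trans _ _ (\int[marginal Q]_x (g x)%:E)%E).
  apply: ae_ge0_le_integral => //.
  - by move=> x _; rewrite mule_ge0// lee_fin mulr_ge0.
  - apply: emeasurable_funM.
      by apply/measurable_EFinP; exact: measurable_funM.
    have mm := measurable_misclassified mf Q.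
    have := measurable_fun_ysection (iid (law P) n) mm.
    congr measurable_fun; apply/funext => x /=; congr (iid _ _ _).
    by apply/seteqP; split => s; rewrite /ysection/= inE.
  - by move=> x _; rewrite lee_fin.
  - exact/measurable_EFinP.
  exists (~` Om); split => //; first exact: measurableC.
  by apply: subsetC => x Omx _ /=; exact: pt.
have -> : (\int[marginal Q]_x (g x)%:E = eps%:E + \sum_(j < J.+1) (c j)%:E * marginal Q [set x | (z x < 2 ^+ j * de)%R])%E.
  rewrite /g; under eq_integral do rewrite EFinD -sumEFin.
  have m1 (j : 'I_J.+1) : measurable_fun setT (fun x => (c j * \1_[set x | z x < 2 ^+ j * de] x)%:E).
    by apply/measurable_EFinP; apply: measurable_funM => //; exact: measurable_indic.
  rewrite ge0_integralD//; last 2 first.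
  - by move=> x _; apply: sume_ge0 => j _; rewrite lee_fin mulr_ge0.
  - exact: emeasurable_sum.
  rewrite integral_cst// [X in (_ * X)%E](_ : _ = 1%E); last exact: probability_setT.
  rewrite mule1; congr (_ + _)%E.
  rewrite ge0_integral_sum//; last by move=> j x _; rewrite lee_fin mulr_ge0.
  apply: eq_bigr => j _; under eq_integral do rewrite EFinM.
  rewrite ge0_integralZl ?lee_fin//.
    by rewrite integral_indic// setIT.
  by apply/measurable_EFinP; exact: measurable_indic.
rewrite EFinD; apply: leeD => //.
pose C := Num.max Ca (2 `^ al).
have C0 : 0 <= C by rewrite le_max powR_ge0 orbT.
(* The mass of the level [2^j de] grows like [2^(j al)], against which [c j] decays like
   [2^(- j (al + 1))]. *)
apply: (@le_trans _ _ (\sum_(j < J.+1) (K * C * de `^ (1 + al) * 2^-1 ^+ j)%:E)%E).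
  apply: lee_sum => j _.
  have t0 : 0 < 2 ^+ j * de :> R by rewrite mulr_gt0// exprn_gt0.
  have cj0 : (0 <= (c j)%:E)%E by rewrite lee_fin.
  apply: (le_trans (lee_wpmul2l cj0 (tsybakov_all al0 TN t0))).
  rewrite -EFinM lee_fin le_eqVlt; apply/orP; left; apply/eqP.
  have j0 : 0 < 2 ^+ j :> R by rewrite exprn_gt0.
  rewrite /c -/C (powRM _ (ltW j0) (ltW de0)) -powR_inv1 ?(ltW j0)// -powRrM.
  rewrite [de `^ (1 + al)]powRD; last by rewrite (gt_eqF de0) implybT.
  rewrite powRr1 ?(ltW de0)// exprVn -[(2 ^+ j)^-1]powR_inv1 ?(ltW j0)//.
  rewrite [X in _ = _ * X](_ : _ = (2 ^+ j) `^ (-1 * (al + 1)) * (2 ^+ j) `^ al); last first.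
    by rewrite -powRD; [congr powR; ring|rewrite (gt_eqF j0) implybT].
  ring.
rewrite sumEFin lee_fin -mulr_sumr.
have gs : \sum_(j < J.+1) 2^-1 ^+ j <= 2 :> R.
  have : \sum_(j < J.+1) (2^-1 : R) ^+ j = 2 - 2^-1 ^+ J.
    elim: (J) => [|m IH]; first by rewrite big_ord1 !expr0; ring.
    by rewrite big_ord_recr/= IH exprS; field.
  by move=> ->; rewrite gerBl exprn_ge0.
have KC : 0 <= K * C * de `^ (1 + al) by rewrite !mulr_ge0 ?powR_ge0//; lra.
by have := ler_wpM2l KC gs; rewrite /K /C; lra.
Qed.

End noise.

(** * Rates *)

Section rates.
Context (R : realType) (d : nat) (hd : (0 < d)%N) (th : params R) (hth : valid_params th).
Local Notation point := (euclid R d).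
Local Notation obs := (point * bool)%type.
Implicit Types (P Q : joint_law R d).

Definition mass_cst : R := c_lambda th ^+ 2 * (2 / d%:R) ^+ d.

Lemma mass_cst_gt0 : 0 < mass_cst.
Proof.
have [_ _ _ _ [_ cl0 _ _]] := hth.
by rewrite mulr_gt0 ?exprn_gt0// divr_gt0// ltr0n.
Qed.

(** What the pointwise bounds use of the class, with the strong density condition already turned
    into a lower bound on the masses of balls. *)
Definition regular_pair P Q (Om : set point) : Prop :=
  [/\ measurable Om, marginal P (~` Om) = 0%E,
      forall x r, Om x -> 0 < r < r_lambda th ->
        ((mass_cst * r ^+ d)%:E <= marginal P (eball x r))%E
    & [/\ holder (C_beta th) (betaP th) Om (eta P),
          holder (C_beta th) (betaQ th) Om (eta Q)
        & relative_signal (C_gamma th) (gamma th) P Q Om]].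

Lemma Pi_class_regular PQ : @Pi_class R d th PQ ->
  exists Om, [/\ regular_pair PQ.1 PQ.2 Om, marginal PQ.2 (~` Om) = 0%E
    & tsybakov_noise (C_alpha th) (alpha th) PQ.2].
Proof.
have [_ _ _ _ [_ cl0 _ _]] := hth.
move=> [Om [_ [OmP OmQ dens [p [q [dp dq pq]]]] [hP hQ] TN RS]].
exists Om; split => //; last by rewrite OmQ; exact: measure_msupportC.
split => //; first by rewrite OmP; exact: measurable_msupport.
  by rewrite OmP; exact: measure_msupportC.
move=> x r Omx /andP[r0 rl].
apply: (ball_mass_ge hd cl0 dp) => //.
  by move=> y; rewrite -OmP => /pq[/andP[]].
by rewrite -OmP; apply: dens => //; rewrite r0.
Qed.

(** [B], [E] and [N] do not depend on the pair, so the dyadic bound passes to the supremum over the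
    class. [eps] is the part of the error that does not depend on [x]. *)
Lemma sup_excess_risk_rate (f : forall n, n.-tuple obs -> point -> bool)
    (de eps : nat -> R) (B E : R) (N : nat) :
  (forall n, measurable [set z : n.-tuple obs * point | f n z.1 z.2]) ->
  0 <= B -> 0 <= E ->
  (forall n, (N <= n)%N -> 0 < de n) ->
  (forall n, (N <= n)%N -> 0 <= eps n <= E * de n `^ (1 + alpha th)) ->
  (forall n, (N <= n)%N -> forall P Q Om, regular_pair P Q Om ->
     forall x, Om x -> 0 < `|eta Q x - 2^-1| ->
     (iid (law P) n [set s | f n s x != bayes Q x] <=
        (eps n + B * (de n / `|eta Q x - 2^-1|) `^ (alpha th + 2))%:E)%E) ->
  lesssim (fun n => sup_excess_risk th (f n)) (fun n => (de n `^ (1 + alpha th))%:E).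
Proof.
move=> mf B0 E0 de0 epsE err; have [al0 _ _ _ _] := hth.
set C := 2 * (2 + 2 * B * 2 `^ (alpha th + 1)) * Num.max (C_alpha th) (2 `^ alpha th).
have C0 : 0 < C.
  rewrite !mulr_gt0 ?lt_max ?powR_gt0 ?orbT//.
  by rewrite ltr_pwDl// !mulr_ge0// powR_ge0.
exists (E + C); first by rewrite ltr_wpDl.
exists N => // n Nn.
apply: ge_ereal_sup => _ [[P Q] /Pi_class_regular[Om /= [PQ Q0 TN]] <-].
have [mOm _ _ _] := PQ.
have /andP[eps0 epsn] := epsE n Nn.
apply: (le_trans (excess_risk_bound (mf n) mOm Q0 al0 B0 (de0 n Nn) eps0 TN (err n Nn P Q Om PQ))).
by rewrite -EFinM lee_fin -/C [leRHS]mulrDl lerD2r.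
Qed.

(** From [u / M <= exp (u / M)]; it trades exponential bounds for powers of a prescribed
    exponent. *)
Lemma expRN_le_powR (u M : R) : 0 < u -> 0 < M -> expR (- u) <= (u / M) `^ (- M).
Proof.
move=> u0 M0; have uM : 0 < u / M by rewrite divr_gt0.
rewrite powRN expRN lef_pV2 ?posrE ?expR_gt0 ?powR_gt0//.
rewrite /powR gt_eqF// ler_expR mulrC -ler_pdivlMr//.
rewrite -[leRHS]expRK ler_ln ?posrE ?expR_gt0//.
by apply: le_trans (expR_ge1Dx _); rewrite lerDr.
Qed.

(* Below the scale de, where the pointwise bounds say nothing, the error is
   bounded by 1. *)
Lemma one_le_powR_ratio (G z de q g : R) : 0 < g -> 0 < z -> 0 < de -> 0 <= q -> 0 < G ->
  z `^ g < G * de `^ g -> 1 <= G `^ (q / g) * (de / z) `^ q.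
Proof.
move=> g0 z0 de0 q0 G0 zG.
have h : (z / de) `^ g <= G.
  rewrite powRM ?invr_ge0 ?(ltW z0) ?(ltW de0)// -powR_inv1 ?(ltW de0)// -powRrM mulN1r powRN.
  by rewrite ler_pdivrMr ?powR_gt0// ltW.
have := @ge0_ler_powR R (q / g) (divr_ge0 q0 (ltW g0)) ((z / de) `^ g) G.
rewrite !nnegrE powR_ge0 (ltW G0) => /(_ isT isT h).
rewrite -powRrM [g * _]mulrC divfK ?gt_eqF// => {}h.
apply: le_trans (ler_wpM2r (powR_ge0 _ _) h).
by rewrite -powRM ?divr_ge0 ?(ltW z0) ?(ltW de0)// mulf_div [de * z]mulrC divff ?powR1// mulf_neq0 ?gt_eqF.
Qed.

Variable be : R.
Hypotheses (be0 : 0 < be) (beE : be = betaP th \/ be = gamma th * betaQ th).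
Let D := 2 * be + d%:R.
Let D0 : 0 < D. Proof. by rewrite addr_gt0 ?mulr_gt0 ?ltr0n. Qed.
Let g0 : 0 < gamma th. Proof. by have [_ _ _ _ []] := hth. Qed.
Let al0 : 0 <= alpha th. Proof. by have [] := hth. Qed.
Let rl0 : 0 < r_lambda th. Proof. by have [_ _ _ _ []] := hth. Qed.
Let d0 : 0 < d%:R :> R. Proof. by rewrite ltr0n. Qed.

(** The value of [|eta Q - 1/2|] whose power [gamma] equals [r^be] for [r = X^(- 1/D)]. [X] is [n]
    for the k-NN classifier and [n / ln^2 n] for the adaptive one. *)
Definition margin_scale (X : R) : R := X `^ (- (be / (gamma th * D))).

Lemma margin_scale_gt0 X : 0 < X -> 0 < margin_scale X.
Proof. exact: powR_gt0. Qed.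

Lemma margin_scale_gamma X : margin_scale X `^ gamma th = X `^ (- (be / D)).
Proof. by rewrite /margin_scale -powRrM; congr powR; field; rewrite !gt_eqF. Qed.

Lemma margin_scale_risk X :
  margin_scale X `^ (1 + alpha th) = X `^ (- ((1 + alpha th) * be / (gamma th * D))).
Proof. by rewrite /margin_scale -powRrM; congr powR; field; rewrite !gt_eqF. Qed.

Lemma radius_be (rho X : R) : 0 < rho -> 0 < X ->
  (rho * X `^ (- D^-1)) `^ be = rho `^ be * margin_scale X `^ gamma th.
Proof.
move=> rho0 X0; rewrite (margin_scale_gamma X) (powRM _ (ltW rho0) (powR_ge0 _ _)).
rewrite -[(X `^ _) `^ be]powRrM.
by congr (_ * powR _ _); field; rewrite gt_eqF.
Qed.

Lemma radius_mass (rho X K : R) : 1 <= rho -> 0 < X -> 0 <= K ->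
  K <= mass_cst * rho ->
  K * X `^ (- (d%:R / D)) <= mass_cst * (rho * X `^ (- D^-1)) ^+ d.
Proof.
move=> rho1 X0 K0 Krho.
have -> : (rho * X `^ (- D^-1)) ^+ d = rho ^+ d * X `^ (- (d%:R / D)).
  rewrite exprMn -[in X in _ * X]powR_mulrn ?powR_ge0// -powRrM.
  by congr (_ * powR _ _); field; rewrite gt_eqF.
rewrite mulrA; apply: ler_wpM2r; first exact: powR_ge0.
(* [rho <= rho ^+ d], as [rho >= 1] and [d > 0]. *)
apply: (le_trans Krho); rewrite ler_pM2l ?mass_cst_gt0//.
by rewrite -[leLHS]expr1 ler_weXn2l.
Qed.

Lemma radius_lt (rho X : R) : 0 < rho -> (rho / r_lambda th) `^ D < X ->
  0 < rho * X `^ (- D^-1) < r_lambda th.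
Proof.
move=> rho0 HX; have X0 : 0 < X by apply: le_lt_trans HX; exact: powR_ge0.
rewrite mulr_gt0 ?powR_gt0//= powRN ltr_pdivrMr ?powR_gt0// mulrC -ltr_pdivrMr//.
have rr : 0 < rho / r_lambda th by rewrite divr_gt0.
rewrite -[ltLHS](powRr1 (ltW rr)) -[1](@divff _ D) ?gt_eqF// powRrM.
by apply: gt0_ltr_powR => //; rewrite ?invr_gt0 ?nnegrE ?powR_ge0 ?(ltW X0).
Qed.

Lemma near_ln_ge (x : R) : exists2 N : nat, (0 < N)%N & forall n, (N <= n)%N -> x <= ln (n%:R : R).
Proof.
exists (Num.bound (expR x)).+1 => // n nN.
have e0 := expR_gt0 x.
have nx : expR x <= n%:R.
  apply: ltW; apply: lt_le_trans (_ : (Num.bound (expR x))%:R <= _).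
    exact/archi_boundP/ltW.
  by rewrite ler_nat ltnW.
rewrite -[leLHS]expRK ler_ln ?posrE//.
exact: lt_le_trans nx.
Qed.

(** Above a multiple of the scale [de], [f_NN_error] applies with the radius [rho n^(- 1/D)]. Its
    first exponential goes into [eps] and is traded for [de^(1 + alpha)]; the second one is traded
    for [(de / zeta)^(alpha + 2)]. *)
Lemma f_NN_rate (k : nat -> nat) :
  (forall n, (0 < n)%N -> (1 <= k n <= n)%N) ->
  asymp (fun n => (k n)%:R%:E : \bar R) (fun n => (n%:R `^ (2 * be / D))%:E) ->
  lesssim (fun n => sup_excess_risk th (@f_NN R d n (k n)))
    (fun n => (n%:R `^ (- ((1 + alpha th) * be / (gamma th * D))))%:E).
Proof.
move=> kn [[c2 c20 [N2 _ H2]] [c1 c10 [N1 _ H1]]].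
have [A [cm [A0 cm0 margin]]] := margin_persists d hth beE.
have mc0 := mass_cst_gt0.
(* The ball of radius rho n^(-1/D) holds at least 4 k observations on average. *)
pose rho := 1 + 4 * c2 / mass_cst.
have c24 : 0 < 4 * c2 by exact: mulr_gt0.
have rho1 : 1 <= rho by rewrite lerDl ltW// divr_gt0.
have rho0 : 0 < rho by exact: (lt_le_trans ltr01 rho1).
pose G := A * rho `^ be.
have G0 : 0 < G by rewrite mulr_gt0 ?powR_gt0.
(* With [k] of order [de^(- 2 gamma)], the power [- M] of [k zeta^(2 gamma)] is of order
   [(de / zeta)^(alpha + 2)], and the power [- M'] of [k] is of order [de^(1 + alpha)]. *)
pose M := (alpha th + 2) / (2 * gamma th).
have a2 : 0 < alpha th + 2 by rewrite ltr_wpDl.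
have a1 : 0 < 1 + alpha th by rewrite ltr_pwDl.
have M0 : 0 < M by rewrite divr_gt0 ?mulr_gt0.
pose M' := (1 + alpha th) / (2 * gamma th).
have M'0 : 0 < M' by rewrite divr_gt0 ?mulr_gt0.
(* The quantity [k m^2 / 2] of [f_NN_error], divided by [M], is at least
   [q (zeta / de)^(2 gamma)]. *)
pose q := cm ^+ 2 / (2 * c1 * M).
have cM0 : 0 < 2 * c1 * M by apply: mulr_gt0 => //; exact: mulr_gt0.
have q0 : 0 < q by rewrite divr_gt0// exprn_gt0.
(* Adding 1 keeps the argument of the logarithm positive and makes the resulting inequality strict,
   so that the radius falls below [r_lambda]. *)
have [N3 N30 H3] := near_ln_ge (ln (1 + (rho / r_lambda th) `^ D)).
pose N := maxn (maxn N1 N2) N3.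
have -> : (fun n => (n%:R `^ (- ((1 + alpha th) * be / (gamma th * D))))%:E) =
    (fun n => (margin_scale n%:R `^ (1 + alpha th))%:E : \bar R).
  by apply/funext => n; rewrite margin_scale_risk.
have nD n : (N <= n)%N -> [/\ 0 < n%:R :> R, (0 < n)%N, (k n)%:R <= c2 * n%:R `^ (2 * be / D),
    n%:R `^ (2 * be / D) <= c1 * (k n)%:R & (rho / r_lambda th) `^ D < n%:R].
  rewrite !geq_max => /andP[/andP[n1 n2] n3].
  have n0 : (0 < n)%N by exact: leq_trans n3.
  have n0' : 0 < n%:R :> R by rewrite ltr0n.
  split => //; [by have := H2 n n2; rewrite /= -EFinM lee_fin|
    by have := H1 n n1; rewrite /= -EFinM lee_fin|].
  have pr : 0 <= (rho / r_lambda th) `^ D by exact: powR_ge0.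
  have := H3 n n3; rewrite ler_ln ?posrE//; first lra.
  by rewrite ltr_pwDl.
have scale n : 0 < n%:R :> R -> n%:R `^ (2 * be / D) * margin_scale n%:R `^ (2 * gamma th) = 1.
  move=> n0; rewrite /margin_scale -powRrM -powRD ?(gt_eqF n0) ?implybT//.
  by rewrite (_ : _ + _ = 0) ?powRr0//; field; rewrite !gt_eqF.
apply: (@sup_excess_risk_rate (fun n => @f_NN R d n (k n)) (fun n => margin_scale n%:R)
  (fun n => expR (- (k n)%:R)) (G `^ ((alpha th + 2) / gamma th) + q `^ (- M))
  ((c1 * M')^-1 `^ (- M')) N).
- by move=> n; exact: measurable_f_NN.
- by rewrite addr_ge0// powR_ge0.
- exact: powR_ge0.
- by move=> n /nD[n0 _ _ _ _]; exact: margin_scale_gt0.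
- move=> n /nD[n0 n0' _ kl _]; rewrite expR_ge0/=.
  have k0 : 0 < (k n)%:R :> R by rewrite ltr0n; have /andP[] := kn n n0'.
  apply: (le_trans (expRN_le_powR k0 M'0)).
  have de0 := margin_scale_gt0 n0.
  have -> : margin_scale n%:R `^ (1 + alpha th) = (n%:R `^ (2 * be / D)) `^ (- M').
    rewrite margin_scale_risk -powRrM; congr powR; rewrite /M'; field; rewrite !gt_eqF//.
  rewrite -powRM ?powR_ge0 ?invr_ge0 ?(ltW (mulr_gt0 c10 M'0))//.
  have p1 : 0 < (c1 * M')^-1 by rewrite invr_gt0; exact: mulr_gt0.
  have p2 : 0 < n%:R `^ (2 * be / D) :> R by exact: powR_gt0.
  have p3 := divr_gt0 k0 M'0; have p4 := mulr_gt0 p1 p2.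
  rewrite !powRN lef_pV2 ?posrE ?powR_gt0//.
  apply: ge0_ler_powR; rewrite ?nnegrE ?(ltW M'0)//.
  + exact: ltW.
  + exact: ltW.
  by rewrite invfM mulrAC ler_pM2r ?invr_gt0// [leLHS]mulrC ler_pdivrMr// [leRHS]mulrC.
- move=> n /nD[n0 n0' ku kl rn] P Q Om [mOm Om1 mass [hP hQ RS]] x Omx z0.
  set z := `|eta Q x - 2^-1| in z0 *; set de := margin_scale n%:R.
  have de0 : 0 < de by exact: margin_scale_gt0.
  have dz0 : 0 <= (de / z) `^ (alpha th + 2) by exact: powR_ge0.
  have k0 : 0 < (k n)%:R :> R by rewrite ltr0n; have /andP[] := kn n n0'.
  have mm := measurable_pair_cst x (measurable_misclassified (@measurable_f_NN R d n (k n)) Q).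
  have [zG|zG] := ltP (z `^ gamma th) (G * de `^ gamma th).
    apply: (le_trans (probability_le1 (iid (law P) n) mm)); rewrite lee_fin.
    apply: (le_trans (one_le_powR_ratio g0 z0 de0 (ltW a2) G0 zG)).
    by rewrite [X in _ <= _ + X]mulrDl [leRHS]addrC -[leRHS]addrA lerDl addr_ge0 ?expR_ge0// mulr_ge0// powR_ge0.
  pose r := rho * n%:R `^ (- D^-1).
  have rr : 0 < r < r_lambda th by exact: radius_lt.
  have /andP[r0 _] := rr.
  have Ar : A * r `^ be <= z `^ gamma th.
    by rewrite /r (radius_be rho0 n0) mulrA; exact: zG.
  (* [n] times the mass of the ball dominates [4 c2 n^(1 - d/D)], and [1 - d/D = 2 be / D] is the
     exponent in the order of [k]. *)
  have kp : 4 * (k n)%:R <= n%:R * (mass_cst * r ^+ d).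
    apply: (@le_trans _ _ (n%:R * (4 * c2 * n%:R `^ (- (d%:R / D))))); last first.
      rewrite ler_pM2l//; apply: radius_mass => //; first by rewrite mulr_ge0// ltW.
      rewrite (_ : mass_cst * rho = mass_cst + 4 * c2); first by rewrite lerDr ltW.
      by rewrite /rho; field; rewrite gt_eqF.
    rewrite (_ : n%:R * _ = 4 * (c2 * n%:R `^ (2 * be / D))); first by rewrite ler_pM2l.
    rewrite (_ : 2 * be / D = 1 + - (d%:R / D)); last by rewrite /D; field; rewrite gt_eqF.
    rewrite powRD ?(gt_eqF n0) ?implybT// powRr1 ?(ltW n0)//; ring.
  have m0 : 0 <= cm * z `^ gamma th by rewrite mulr_ge0 ?powR_ge0 ?ltW.
  apply: (le_trans (f_NN_error mOm Om1 Omx m0 (kn n n0') (ltW r0) (mass x r Omx rr) kp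
    (margin P Q Om hP hQ RS x r Omx (ltW r0) z0 Ar))).
  rewrite -EFinD lee_fin lerD2l [leRHS]mulrDl.
  apply: (@le_trans _ _ (q `^ (- M) * (de / z) `^ (alpha th + 2))); last first.
    by rewrite lerDr mulr_ge0// powR_ge0.
  have zg : 0 < z `^ gamma th by exact: powR_gt0.
  have u0 : 0 < (k n)%:R * (cm * z `^ gamma th) ^+ 2 / 2.
    by rewrite divr_gt0 ?mulr_gt0// exprn_gt0// mulr_gt0.
  apply: (le_trans (expRN_le_powR u0 M0)).
  have zd0 : 0 < z / de by rewrite divr_gt0.
  have -> : (de / z) `^ (alpha th + 2) = ((z / de) `^ (2 * gamma th)) `^ (- M).
    rewrite -powRrM -[de / z]invf_div -[(z / de)^-1]powR_inv1 ?(ltW zd0)// -powRrM.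
    by congr powR; rewrite /M; field; rewrite gt_eqF.
  rewrite -powRM ?powR_ge0 ?(ltW q0)//.
  have p1 := mulr_gt0 q0 (powR_gt0 (2 * gamma th) zd0); have p2 := divr_gt0 u0 M0.
  rewrite !powRN lef_pV2 ?posrE ?powR_gt0//.
  apply: ge0_ler_powR; rewrite ?nnegrE ?(ltW M0) ?(ltW p1) ?(ltW p2)//.
  have zd : (z / de) `^ (2 * gamma th) = (z `^ gamma th) ^+ 2 * n%:R `^ (2 * be / D).
    have := scale n n0; rewrite -/de => sc.
    rewrite powRM ?invr_ge0 ?(ltW z0) ?(ltW de0)// -powR_inv1 ?(ltW de0)// -powRrM mulN1r powRN.
    rewrite -[(_ `^ _) ^+ 2]powR_mulrn ?powR_ge0// -powRrM [gamma th * 2]mulrC.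
    congr (_ * _); apply: (mulIf (lt0r_neq0 (powR_gt0 (2 * gamma th) de0))).
    by rewrite mulVf ?sc// lt0r_neq0// powR_gt0.
  rewrite zd (_ : q * _ = (cm * z `^ gamma th) ^+ 2 / (2 * M) * (n%:R `^ (2 * be / D) / c1));
    last first.
    by rewrite /q; field; rewrite !gt_eqF.
  rewrite (_ : (k n)%:R * _ / 2 / M = (cm * z `^ gamma th) ^+ 2 / (2 * M) * (k n)%:R); last first.
    by field; rewrite !gt_eqF.
  have p5 : 0 < (cm * z `^ gamma th) ^+ 2 / (2 * M).
    by apply: divr_gt0; [rewrite exprn_gt0//; exact: mulr_gt0|exact: mulr_gt0].
  by rewrite (ler_pM2l p5) ler_pdivrMr// [leRHS]mulrC.
Qed.

(** The cube of [ln x / 3 <= x^(1/3)]. It makes [n / ln^2 n] large as soon as [ln n] is. *)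
Lemma ratio_ln_sqr_ge (x : R) : 0 < x -> 0 < ln x -> ln x / 27 <= x / ln x ^+ 2.
Proof.
move=> x0 L0; have L2 : 0 < ln x ^+ 2 by rewrite exprn_gt0.
rewrite ler_pdivlMr//.
have e1 : ln x / 3 <= expR (ln x / 3) by apply: le_trans (expR_ge1Dx _); rewrite lerDr.
have e3 : expR (ln x / 3) ^+ 3 = x.
  by rewrite -expRM_natr -mulrA mulVf ?mulr1 ?lnK ?posrE.
rewrite -[leRHS]e3 (_ : ln x / 27 * ln x ^+ 2 = (ln x / 3) ^+ 3); last by field.
by rewrite lerXn2r ?nnegrE ?expR_ge0// divr_ge0// ltW.
Qed.

(** The comparison is with a balanced number of neighbors [ks], unknown to the classifier. Above a
    multiple of the scale, [f_pa_error] leaves only [eps]; the power of [de / zeta] accounts for the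
    points below. *)
Lemma f_pa_rate :
  lesssim (fun n => sup_excess_risk th (@f_pa R d n))
    (fun n => ((n%:R / ln n%:R ^+ 2) `^ (- ((1 + alpha th) * be / (gamma th * D))))%:E).
Proof.
have [A [cm [A0 cm0 margin]]] := margin_persists d hth beE.
have mc0 := mass_cst_gt0.
(* The 8 is the 4 of the ball count times the 2 of [ks <= 2 ka]. *)
pose rho := 1 + 8 / mass_cst.
have rho1 : 1 <= rho by rewrite lerDl ltW// divr_gt0.
have rho0 : 0 < rho by exact: (lt_le_trans ltr01 rho1).
have a2 : 0 < alpha th + 2 by rewrite ltr_wpDl.
have a1 : 0 < 1 + alpha th by rewrite ltr_pwDl.
have d10 : 0 < d%:R + 1 :> R by rewrite ltr_pwDr.
(* The first summand lets the margin persist over the ball; the second makes the margin times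
   [sqrt ks] reach twice the threshold. *)
pose G := A * rho `^ be + 2 * (d%:R + 1) / cm.
have G1 : 0 < A * rho `^ be by rewrite mulr_gt0 ?powR_gt0.
have G2 : 0 < 2 * (d%:R + 1) / cm by apply: divr_gt0 => //; exact: mulr_gt0.
have G0 : 0 < G by exact: addr_gt0.
pose M := (1 + alpha th) / (2 * gamma th).
have M0 : 0 < M by rewrite divr_gt0 ?mulr_gt0.
pose s := (1 + alpha th) * be / (gamma th * D).
have s0 : 0 < s by apply: divr_gt0; exact: mulr_gt0.
(* The factor 27 turns a bound on [ln n] into one on [X n] by [ratio_ln_sqr_ge]; the last summand
   serves to absorb the number of events in the union bound. *)
pose T := 27 * (2 `^ (D / d%:R) + (rho / r_lambda th) `^ D + 1) + 2 * (s + 1).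
have T1 : 0 <= 2 `^ (D / d%:R) :> R by exact: powR_ge0.
have T2 : 0 <= (rho / r_lambda th) `^ D by exact: powR_ge0.
have [N N0 HN] := near_ln_ge T.
pose X n : R := n%:R / ln n%:R ^+ 2.
pose ka n := n%:R * X n `^ (- (d%:R / D)).
pose ks n := (Num.truncn (ka n)).+1.
pose eps n := expR (- (ks n)%:R) + (ks n).+1%:R * expR (- (threshold R d n ^+ 2 / 2)).
have -> : (fun n => ((n%:R / ln n%:R ^+ 2) `^ (- ((1 + alpha th) * be / (gamma th * D))))%:E) =
    (fun n => (margin_scale (X n) `^ (1 + alpha th))%:E : \bar R).
  by apply/funext => n; rewrite margin_scale_risk.
have basic n : (N <= n)%N -> [/\ 1 <= n%:R :> R, 1 <= ln (n%:R : R), 2 * (s + 1) <= ln (n%:R : R),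
    2 `^ (D / d%:R) <= X n & (rho / r_lambda th) `^ D < X n].
  move=> nN; have L := HN n nN.
  have n1 : 1 <= n%:R :> R by rewrite ler1n (leq_trans N0).
  have n0 : 0 < n%:R :> R by exact: (lt_le_trans ltr01 n1).
  have L0 : 0 < ln (n%:R : R) by move: L; rewrite /T; lra.
  have := ratio_ln_sqr_ge n0 L0; rewrite -/(X n) => XL.
  by split => //; move: L; rewrite /T; lra.
have scale n : (N <= n)%N -> [/\ 0 < X n, X n <= n%:R, n%:R `^ (2 * be / D) <= (ks n)%:R,
    ka n <= (ks n)%:R & (ks n)%:R <= 2 * ka n] /\ 2 * ka n <= n%:R.
  move=> nN; have [n1 L1 _ X2 _] := basic n nN.
  have n0 : 0 < n%:R :> R by exact: (lt_le_trans ltr01 n1).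
  have X0 : 0 < X n by apply: lt_le_trans X2; exact: powR_gt0.
  have Xn : X n <= n%:R.
    rewrite ler_pdivrMr ?exprn_gt0 ?(lt_le_trans ltr01 L1)//.
    by rewrite ler_peMr ?(ltW n0)// exprn_ege1.
  have dD : 0 <= d%:R / D by rewrite divr_ge0// ltW.
  have kn : n%:R `^ (2 * be / D) <= ka n.
    rewrite (_ : 2 * be / D = 1 + - (d%:R / D)); last by rewrite /D; field; rewrite gt_eqF.
    rewrite powRD ?(gt_eqF n0) ?implybT// powRr1 ?(ltW n0)// ler_pM2l//.
    rewrite !powRN lef_pV2 ?posrE ?powR_gt0//.
    by apply: ge0_ler_powR; rewrite ?nnegrE ?(ltW X0) ?(ltW n0).
  have k1 : 1 <= ka n.
    apply: le_trans kn; rewrite -[leLHS](powRr0 n%:R); apply: ler_powR => //.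
    by rewrite divr_ge0 ?mulr_ge0 ?ltW.
  have /andP[t1 t2] := truncn_itv (le_trans ler01 k1).
  split; first split => //.
  - exact: le_trans (ltW t2).
  - exact: ltW.
  - by rewrite /ks -natr1; lra.
  rewrite /ka mulrCA -[leRHS]mulr1 ler_pM2l// powRN ler_pdivrMr ?powR_gt0// mul1r.
  have := @ge0_ler_powR R (d%:R / D) dD (2 `^ (D / d%:R)) (X n).
  rewrite !nnegrE powR_ge0 (ltW X0) => /(_ isT isT X2); rewrite -powRrM.
  by rewrite mulf_div [D * _]mulrC divff ?powRr1// mulf_neq0 ?gt_eqF.
have tau2 n : (N <= n)%N -> threshold R d n ^+ 2 = (d%:R + ln n%:R) * ln n%:R.
  move=> nN; have [_ L1 _ _ _] := basic n nN.
  rewrite /threshold sqr_sqrtr// mulr_ge0// ?addr_ge0//; lra.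
apply: (@sup_excess_risk_rate (fun n => @f_pa R d n) (fun n => margin_scale (X n)) eps
  (G `^ ((alpha th + 2) / gamma th)) (M^-1 `^ (- M) + 2) N).
- by move=> n; exact: measurable_f_pa.
- exact: powR_ge0.
- by rewrite addr_ge0// powR_ge0.
- by move=> n /scale[[X0 _ _ _ _] _]; exact: margin_scale_gt0.
- move=> n nN; have [n1 L1 Ls _ _] := basic n nN.
  have [[X0 Xn nk _ k2] kn] := scale n nN.
  have n0 : 0 < n%:R :> R by exact: (lt_le_trans ltr01 n1).
  apply/andP; split.
    by rewrite addr_ge0 ?expR_ge0// mulr_ge0 ?expR_ge0.
  apply: (@le_trans _ _ ((M^-1 `^ (- M) + 2) * n%:R `^ (- s))); last first.
    rewrite margin_scale_risk -/s; apply: ler_wpM2l; first by rewrite addr_ge0// powR_ge0.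
    rewrite !powRN lef_pV2 ?posrE ?powR_gt0//.
    by apply: ge0_ler_powR; rewrite ?nnegrE ?(ltW X0) ?(ltW n0) ?(ltW s0).
  rewrite [leRHS]mulrDl; apply: lerD.
    have na0 : 0 < n%:R `^ (2 * be / D) :> R by exact: powR_gt0.
    apply: (@le_trans _ _ (expR (- n%:R `^ (2 * be / D)))); first by rewrite ler_expR lerN2.
    apply: (le_trans (expRN_le_powR na0 M0)).
    rewrite powRM ?invr_ge0 ?(ltW na0) ?(ltW M0)// mulrC ler_pM2l; last first.
      by rewrite powR_gt0// invr_gt0.
    rewrite -powRrM le_eqVlt; apply/orP; left; apply/eqP; congr powR.
    by rewrite /M /s; field; rewrite !gt_eqF.
  rewrite tau2//; set L := ln n%:R in L1 Ls *.
  have nE : n%:R = expR L by rewrite /L lnK.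
  (* The union bound has [ks + 1 <= 2 n] terms, each at most [exp (- L^2 / 2)]; [L >= 2 (s + 1)]
     makes the total at most [2 n^(- s)]. *)
  apply: (@le_trans _ _ ((2 * n%:R) * expR (- (L ^+ 2 / 2)))).
    apply: ler_pM; rewrite ?expR_ge0//; first by rewrite -natr1; lra.
    rewrite ler_expR lerN2 ler_pM2r// expr2; apply: ler_wpM2r; first lra.
    by rewrite lerDr.
  rewrite -mulrA ler_pM2l// /powR (gt_eqF n0) -/L nE -expRD ler_expR; nra.
- move=> n nN P Q Om [mOm Om1 mass [hP hQ RS]] x Omx z0.
  have [n1 L1 Ls _ Xr] := basic n nN.
  have [[X0 Xn nk kk k2] kn] := scale n nN.
  have n0 : 0 < n%:R :> R by exact: (lt_le_trans ltr01 n1).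
  set z := `|eta Q x - 2^-1| in z0 *; set de := margin_scale (X n).
  have de0 : 0 < de by exact: margin_scale_gt0.
  have eps0 : 0 <= eps n by rewrite addr_ge0 ?expR_ge0// mulr_ge0 ?expR_ge0.
  have mm := measurable_pair_cst x (measurable_misclassified (@measurable_f_pa R d n) Q).
  have [zG|zG] := ltP (z `^ gamma th) (G * de `^ gamma th).
    apply: (le_trans (probability_le1 (iid (law P) n) mm)); rewrite lee_fin.
    apply: (le_trans (one_le_powR_ratio g0 z0 de0 (ltW a2) G0 zG)).
    by rewrite lerDr.
  pose r := rho * X n `^ (- D^-1).
  have rr : 0 < r < r_lambda th by exact: radius_lt.
  have /andP[r0 _] := rr.
  have deg : 0 < de `^ gamma th by exact: powR_gt0.
  have zG1 : A * rho `^ be * de `^ gamma th <= z `^ gamma th.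
    by apply: le_trans zG; rewrite ler_pM2r// lerDl ltW.
  have zG2 : 2 * (d%:R + 1) / cm * de `^ gamma th <= z `^ gamma th.
    by apply: le_trans zG; rewrite ler_pM2r// lerDr ltW.
  have Ar : A * r `^ be <= z `^ gamma th.
    by rewrite /r (radius_be rho0 X0) mulrA; exact: zG1.
  have kp : 4 * (ks n)%:R <= n%:R * (mass_cst * r ^+ d).
    apply: (@le_trans _ _ (n%:R * (8 * X n `^ (- (d%:R / D))))); last first.
      rewrite ler_pM2l//; apply: radius_mass => //.
      rewrite (_ : mass_cst * rho = mass_cst + 8); first by rewrite lerDr ltW.
      by rewrite /rho; field; rewrite gt_eqF.
    by rewrite mulrCA -/(ka n); lra.
  have m0 : 0 <= cm * z `^ gamma th by rewrite mulr_ge0 ?powR_ge0 ?ltW.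
  have kn' : (1 <= ks n <= n)%N by rewrite /= -(@ler_nat R); exact: le_trans kn.
  have tau0 : 0 < threshold R d n.
    by rewrite sqrtr_gt0 mulr_gt0// ?ltr_wpDl//; lra.
  have sig : 2 * threshold R d n <= cm * z `^ gamma th * Num.sqrt (ks n)%:R.
    rewrite -ler_sqr ?nnegrE ?mulr_ge0 ?sqrtr_ge0// ?(ltW cm0)// ?powR_ge0//.
    rewrite [leLHS]exprMn tau2// [leRHS]exprMn [Num.sqrt _ ^+ 2]sqr_sqrtr//.
    have w : 2 * (d%:R + 1) * de `^ gamma th <= cm * z `^ gamma th.
      by move: zG2; rewrite mulrAC ler_pdivrMr// [leRHS]mulrC.
    have w2 : (2 * (d%:R + 1) * de `^ gamma th) ^+ 2 <= (cm * z `^ gamma th) ^+ 2.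
      rewrite ler_sqr ?nnegrE// mulr_ge0 ?(ltW deg)// mulr_ge0// ltW//.
    (* The choice of [X] balances the scale against the threshold: [X^(- 2 be / D) * n * X^(- d / D)
       = n / X = ln^2 n]. *)
    have kL : (de `^ gamma th) ^+ 2 * ka n = ln n%:R ^+ 2.
      rewrite /de margin_scale_gamma /ka -[in LHS]powR_mulrn ?powR_ge0// -powRrM mulrCA -powRD ?(gt_eqF X0) ?implybT//.
      rewrite (_ : _ + _ = -1); last by rewrite /D; field; rewrite gt_eqF.
      rewrite powR_inv1 ?(ltW X0)// /X invf_div mulrC divfK// gt_eqF//.
    apply: (@le_trans _ _ ((2 * (d%:R + 1) * de `^ gamma th) ^+ 2 * ka n)); last first.
      by apply: ler_pM => //; [exact: sqr_ge0|rewrite mulr_ge0 ?powR_ge0 ?(ltW n0)].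
    rewrite (_ : (2 * (d%:R + 1) * de `^ gamma th) ^+ 2 * ka n =
      4 * (d%:R + 1) ^+ 2 * ln n%:R ^+ 2); last by rewrite -kL; ring.
    set L := ln n%:R in L1 *; have d1 : 0 <= d%:R :> R by [].
    have h1 : (d%:R + L) * L <= (d%:R + 1) * L ^+ 2.
      have h0 : 0 <= d%:R * (L - 1) by rewrite mulr_ge0// subr_ge0.
      by rewrite expr2 mulrA; apply: ler_wpM2r; [exact: le_trans ler01 L1|lra].
    have h2 : (d%:R + 1) * L ^+ 2 <= (d%:R + 1) ^+ 2 * L ^+ 2.
      by apply: ler_wpM2r; [exact: sqr_ge0|rewrite -[leLHS]expr1 ler_weXn2l// lerDr].
    lra.
  apply: (le_trans (f_pa_error mOm Om1 Omx m0 kn' (ltW r0) (mass x r Omx rr) kp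
    (margin P Q Om hP hQ RS x r Omx (ltW r0) z0 Ar) tau0 sig)).
  by rewrite -EFinD lee_fin -/(eps n) lerDl mulr_ge0// powR_ge0.
Qed.

End rates.

(** * The two smoothness regimes *)

Theorem theorem1 (R : realType) (d : nat) (hd : (0 < d)%N)
    (th : params R) (hth : valid_params th) :
  [/\ (* 1a *)
      gamma th * betaQ th < betaP th ->
      forall k : nat -> nat,
        (forall n, (0 < n)%N -> (1 <= k n <= n)%N) ->
        asymp (fun n => (k n)%:R%:E : \bar R)
          (fun n => (n%:R `^ (2 * betaP th / (2 * betaP th + d%:R)))%:E) ->
        lesssim (fun n => sup_excess_risk th (@f_NN R d n (k n)))
          (fun n => (n%:R `^ (- ((1 + alpha th) * betaP th
                                 / (gamma th * (2 * betaP th + d%:R)))))%:E),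
      (* 1b *)
      betaP th <= gamma th * betaQ th ->
      forall k : nat -> nat,
        (forall n, (0 < n)%N -> (1 <= k n <= n)%N) ->
        asymp (fun n => (k n)%:R%:E : \bar R)
          (fun n => (n%:R `^ (2 * gamma th * betaQ th
                              / (2 * gamma th * betaQ th + d%:R)))%:E) ->
        lesssim (fun n => sup_excess_risk th (@f_NN R d n (k n)))
          (fun n => (n%:R `^ (- ((1 + alpha th) * betaQ th
                                 / (2 * gamma th * betaQ th + d%:R))))%:E),
      (* 2a *)
      gamma th * betaQ th < betaP th ->
        lesssim (fun n => sup_excess_risk th (@f_pa R d n))
          (fun n => ((n%:R / ln n%:R ^+ 2)
                       `^ (- ((1 + alpha th) * betaP th
                              / (gamma th * (2 * betaP th + d%:R)))))%:E)
    & (* 2b *)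
      betaP th <= gamma th * betaQ th ->
        lesssim (fun n => sup_excess_risk th (@f_pa R d n))
          (fun n => ((n%:R / ln n%:R ^+ 2)
                       `^ (- ((1 + alpha th) * betaQ th
                              / (2 * gamma th * betaQ th + d%:R))))%:E)].
Proof.
have [_ /andP[bP0 _] /andP[bQ0 _] bmax [g0 _ _ _]] := hth.
have d0 : 0 < d%:R :> R by rewrite ltr0n.
have aE : gamma th * betaQ th < betaP th -> 0 < betaP th.
  by apply: le_lt_trans; rewrite mulr_ge0// ltW.
(* In this regime [betaQ = 0] would force [betaP = 0], against the positivity of their maximum. *)
have bE : betaP th <= gamma th * betaQ th -> 0 < gamma th * betaQ th.
  move=> h; rewrite mulr_gt0//; move: bmax; rewrite lt_max => /orP[b0|//].
  by have := lt_le_trans b0 h; rewrite pmulr_rgt0.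
(* With [be = gamma * betaQ] the factor [gamma] cancels from the exponent of the rate. *)
have expE (D := 2 * gamma th * betaQ th + d%:R) : 0 < D ->
    (1 + alpha th) * betaQ th / D =
    (1 + alpha th) * (gamma th * betaQ th) / (gamma th * (2 * (gamma th * betaQ th) + d%:R)).
  by rewrite /D mulrA => D0; field; rewrite !gt_eqF//= mulrA.
have D0 : betaP th <= gamma th * betaQ th -> 0 < 2 * gamma th * betaQ th + d%:R.
  by move=> /bE h; rewrite -mulrA addr_gt0// mulr_gt0.
split.
- by move=> /aE bP k kn; apply: f_NN_rate => //; left.
- move=> h k kn kE; rewrite (expE (D0 h)).
  by apply: f_NN_rate => //; [exact: bE|right|rewrite mulrA].
- by move=> /aE bP; apply: f_pa_rate => //; left.
- by move=> h; rewrite (expE (D0 h)); apply: f_pa_rate => //; [exact: bE|right].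
Qed.
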